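(* Let $\beta$ be an integer and let $\rho,\gamma,\alpha,\alpha_0,\beta_0$ be positive integers satisfying: (1) $\gcd(\alpha_0\beta_0\rho,\gamma)=1$ and $\gcd(\alpha,\beta)=1$; (2) for each prime $p$ dividing $\beta$, also $p^2$ divides $\beta$; (3) $\alpha_0$ is a squarefree divisor of $\alpha$; (4) $\beta_0$ is a squarefree divisor of $\beta$; (5) $\alpha\beta_0\rho+\beta\not\equiv 0\pmod{p^2}$ for every prime $p$ dividing $\gamma$. Define $U(X)$ to be the number of positive integers $y\le X$ such that $y\equiv \rho\pmod{\gamma^2}$, $\gcd(y,\alpha_0\beta_0)=1$, $y$ is squarefree, and $\alpha\beta_0 y+\beta$ is squarefree. Then \[ U(X) = X \left( \frac{ \varphi(\alpha_0 \beta_0)}{\alpha_0 \beta_0 \gamma^2 \zeta(2)} \right) \prod_{p \mid \alpha_0 \beta_0 \gamma} \left( 1 - \frac{1}{p^2} \right)^{-1} \prod_{p \nmid \alpha \beta \gamma} \left( 1 - \frac{1}{p^2-1} \right) + O\left( X^{3/4} \right), \] where the products run over primes $p$, $\varphi$ is Euler's totient function, $\zeta$ is the Riemann zeta function, and the implied constant depends on $\gamma$, $\alpha$, $\alpha_0$, $\beta$ and $\beta_0$.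
   Context: An integer $N$ is squarefree if no square of a prime divides $N$ (equivalently, the Möbius function satisfies $\mu(N)\neq 0$). *)

(* Defs.v *)
From mathcomp Require Import all_boot all_order all_algebra.
From mathcomp Require Import all_classical all_reals all_analysis.

Set Implicit Arguments.
Unset Strict Implicit.
Unset Printing Implicit Defensive.

Import Order.TTheory GRing.Theory Num.Theory.
Import numFieldNormedType.Exports.

Local Open Scope ring_scope.
Local Open Scope classical_set_scope.

(* 0 is not squarefree. *)
Definition squarefree (N : int) : Prop :=
  forall p : nat, prime p -> ~~ ((p ^ 2)%N%:Z %| N)%Z.

(* [Num.truncn X] is the floor of X when 0 <= X. *)
Definition U (R : realType) (beta : int) (gamma alpha alpha0 beta0 rho : nat)
    (X : R) : nat :=
  count (fun y : nat =>
    [&& y == rho %[mod gamma ^ 2],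
        coprime y (alpha0 * beta0),
        `[< squarefree y%:Z >]
      & `[< squarefree ((alpha * beta0 * y)%N%:Z + beta) >]])
    (iota 1 (Num.truncn X)).

(* The Riemann zeta function at a real argument s; meaningful for 1 < s. *)
Definition zeta (R : realType) (s : R) : R :=
  limn (series (fun n : nat => n.+1%:R `^ (- s))).

(* The product of F p over the primes p satisfying P, as the limit of the
   partial products over p < n. *)
Definition prime_product (R : realType) (P : pred nat) (F : nat -> R) : R :=
  limn (fun n : nat => \prod_(0 <= p < n | prime p && P p) F p).

(* Main.v *)
Require Import Defs.
From mathcomp Require Import all_boot all_order all_algebra.
From mathcomp Require Import all_classical all_reals all_analysis.
From mathcomp Require Import zify ring lra.

Import Order.TTheory GRing.Theory Num.Theory.
Import numFieldNormedType.Exports.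

Local Open Scope ring_scope.

(** Put [g y = |alpha beta0 y + beta|]. As [beta] is squarefull and coprime to
    [alpha], a [y] in the right residue class is counted by [U] iff [p^2] does
    not divide [y] for [p] prime to [alpha0 beta0 gamma] and [p^2] does not
    divide [g y] for [p] prime to [alpha beta gamma].

    Detect both conditions with the Moebius function, over [d1^2 | y] with
    [d1 = O(sqrt N)] and [d2^2 | g y] with [d2 <= w], where [w] is about
    [N^(1/4)]. The discarded [d2 > w] cost [O(N/w + sqrt N)], and each of the
    [O(w sqrt N)] remaining pairs contributes [N] times a density which is
    [O(1/(d1 d2)^2)], up to [O(1)]. Hence the count [V N] is
    [N c_N + O(N^(3/4))], with [c_N] a partial sum of an absolutely convergent
    double series, and [V N / N - V N' / N' = O(N^(-1/4))] for [N <= N'].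

    The limit of [V N' / N'] is found without summing that series: sieving by
    the primes up to [z] only leaves a periodic set, whose density is a finite
    Euler product by the Chinese remainder theorem, and changes [V N' / N'] by
    [O(1/z + N'^(-1/2))]. *)

(** * Counting periodic sets in windows *)

Section PeriodicCounting.
Local Open Scope nat_scope.
Variables (P : pred nat) (m : nat).
Hypotheses (m_gt0 : 0 < m) (P_per : forall y, P (y + m) = P y).

Lemma count_iotaS (Q : pred nat) (s n : nat) :
  count Q (iota s n.+1) = count Q (iota s n) + Q (s + n).
Proof. by rewrite -addn1 iotaD count_cat /= addn0. Qed.

Lemma periodic_mod (y : nat) : P (y %% m) = P y.
Proof.
rewrite [in RHS](divn_eq y m) addnC.
by elim: (y %/ m) => [|k IH]; rewrite ?addn0 // mulSn addnCA addnC P_per.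
Qed.

Lemma periodic_eqmod (y z : nat) : y = z %[mod m] -> P y = P z.
Proof. by move=> yz; rewrite -periodic_mod yz periodic_mod. Qed.

Lemma count_period (s : nat) : count P (iota s m) = count P (iota 0 m).
Proof.
elim: s => [//|s IH]; rewrite -IH.
have := count_iotaS P s m; rewrite /= P_per => H.
by apply: (@addnI (P s)); rewrite H addnC.
Qed.

Lemma count_periods (s k : nat) :
  count P (iota s (k * m)) = k * count P (iota 0 m).
Proof.
elim: k s => [|k IH] s; first by rewrite !mul0n.
by rewrite !mulSn iotaD count_cat count_period IH.
Qed.

(** Full periods contribute exactly, so only the last incomplete one errs. The error is the number
    of hits in a period, not its length [m]; it therefore stays bounded for sparse sets of large
    period. *)
Lemma count_periodic_approx (R : realFieldType) (s N : nat) :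
  (`|(count P (iota s N))%:R - N%:R * ((count P (iota 0 m))%:R / m%:R)|
    <= (count P (iota 0 m))%:R :> R)%R.
Proof.
set c := count P (iota 0 m).
rewrite {1 2}(divn_eq N m) iotaD count_cat count_periods -/c.
set q := N %/ m; set r := N %% m.
set e := count P (iota (s + q * m) r).
have rm : r < m by rewrite ltn_mod.
have ec : e <= c.
  have -> : c = count P (iota (s + q * m) (r + (m - r))).
    by rewrite subnKC ?count_period // ltnW.
  by rewrite iotaD count_cat leq_addr.
have m0 : (0 < m%:R :> R)%R by rewrite ltr0n.
rewrite !natrD !natrM.
set x := (X in (`|X| <= _)%R).
have -> : x = (e%:R - r%:R / m%:R * c%:R)%R.
  rewrite /x; field; by rewrite gt_eqF.
have ec' : (e%:R <= c%:R :> R)%R by rewrite ler_nat.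
have e0 : (0 <= e%:R :> R)%R by [].
have c0 : (0 <= c%:R :> R)%R by [].
have t0 : (0 <= r%:R / m%:R :> R)%R by rewrite divr_ge0.
have t1 : (r%:R / m%:R <= 1 :> R)%R by rewrite ler_pdivrMr // mul1r ler_nat ltnW.
have := ler_wpM2r c0 t1; have := mulr_ge0 t0 c0.
by rewrite ler_norml => A B; apply/andP; split; lra.
Qed.

End PeriodicCounting.

(** * Sets contained in a single residue class *)

Section Spacing.
Local Open Scope nat_scope.
Variables (P : pred nat) (m : nat).
Hypotheses (m_gt0 : 0 < m)
  (P_sep : forall y z, P y -> P z -> y = z %[mod m]).

Lemma count_separated_window (s : nat) : count P (iota s m) <= 1.
Proof.
rewrite -size_filter; set l := (X in (size X <= _)%N).
have lu : uniq l by rewrite filter_uniq ?iota_uniq.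
have inl y : y \in l -> P y /\ s <= y < s + m.
  by rewrite mem_filter mem_iota => /andP[].
case: l lu inl => [//|y [//|z l]] /= /andP[] + _ inl.
have [Py yb] := inl y (mem_head _ _).
have [|Pz zb] := inl z; first by rewrite !inE eqxx orbT.
suff -> : y = z by rewrite mem_head.
have : y - s = z - s %[mod m].
  by apply/eqP; rewrite -(eqn_modDr s) !subnK ?(P_sep y z) //; lia.
by rewrite !modn_small; lia.
Qed.

Lemma count_separated_windows (s k : nat) : count P (iota s (k * m)) <= k.
Proof.
elim: k s => [|k IH] s; first by rewrite mul0n.
by rewrite mulSn iotaD count_cat -add1n leq_add ?count_separated_window.
Qed.

Lemma count_separated (s N : nat) : count P (iota s N) <= (N %/ m).+1.
Proof.
apply: leq_trans (count_separated_windows s _).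
have -> : (N %/ m).+1 * m = N + ((N %/ m).+1 * m - N).
  by rewrite subnKC //; apply/ltnW; rewrite ltn_ceil.
by rewrite iotaD count_cat leq_addr.
Qed.

Lemma count_separated_le (R : realFieldType) (s N : nat) :
  ((count P (iota s N))%:R <= N%:R / m%:R + 1 :> R)%R.
Proof.
apply: (@le_trans _ _ (N %/ m).+1%:R); first by rewrite ler_nat count_separated.
rewrite -addn1 natrD lerD2r ler_pdivlMr ?ltr0n // -natrM ler_nat.
exact: leq_divM.
Qed.

End Spacing.

(** * The Chinese remainder theorem as a count *)

Section Chinese.
Local Open Scope nat_scope.

Lemma count_iota_sum (P : pred nat) (n : nat) :
  count P (iota 0 n) = \sum_(i < n) P i.
Proof.
rewrite -sum1_count big_mkcond /= -{1}[n]subn0 -/(index_iota 0 n) big_mkord.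
by apply: eq_bigr => i _; case: (P i).
Qed.

(** Residues modulo [m * n] correspond to pairs of residues, so densities of periodic sets with
    coprime periods multiply. *)
Lemma count_chinese (P Q : pred nat) (m n : nat) :
  0 < m -> 0 < n -> coprime m n ->
  (forall y, P (y + m) = P y) -> (forall y, Q (y + n) = Q y) ->
  count (predI P Q) (iota 0 (m * n)) = count P (iota 0 m) * count Q (iota 0 n).
Proof.
move=> m0 n0 mn Pp Qp.
have mn0 : 0 < m * n by rewrite muln_gt0 m0.
rewrite !count_iota_sum big_distrlr /= pair_big /=.
pose h (x : 'I_m * 'I_n) : 'I_(m * n) :=
  Ordinal (ltn_pmod (chinese m n x.1 x.2) mn0).
pose h' (x : 'I_(m * n)) : 'I_m * 'I_n :=
  (Ordinal (ltn_pmod x m0), Ordinal (ltn_pmod x n0)).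
rewrite (reindex_onto h h') /= => [|i _]; last first.
  apply: val_inj; rewrite /= -[RHS](modn_small (ltn_ord i)).
  apply/eqP; rewrite chinese_remainder //.
  by rewrite chinese_modl // chinese_modr // !modn_mod !eqxx.
apply: eq_big => [[i j]|[i j] _] /=.
  apply/eqP; congr pair; apply: val_inj => /=.
    by rewrite modn_dvdm ?dvdn_mulr // chinese_modl // modn_small.
  by rewrite modn_dvdm ?dvdn_mull // chinese_modr // modn_small.
rewrite mulnb; congr (nat_of_bool (_ && _)).
  rewrite -(periodic_mod _ _ Pp) modn_dvdm ?dvdn_mulr // chinese_modl //.
  exact: periodic_mod.
rewrite -(periodic_mod _ _ Qp) modn_dvdm ?dvdn_mull // chinese_modr //.
exact: periodic_mod.
Qed.

End Chinese.

(** * The Moebius function and linear forms *)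

(* No prime is away from [Q = 0], so [squarefree_away 0] always holds and
   [moebius_away 0] is supported at 1; this is the case [beta = 0] of the
   theorem. *)
Definition squarefree_away (Q n : nat) : bool :=
  `[< forall p : nat, prime p -> ~~ (p %| Q)%N -> ~~ (p ^ 2 %| n)%N >].

Definition moebius_away {R : pzRingType} (Q d : nat) : R :=
  if [&& (0 < d)%N, coprime d Q & all (fun p => ~~ (p ^ 2 %| d)%N) (primes d)]
  then (-1) ^+ size (primes d) else 0.

Lemma squarefree_awayPn (Q n : nat) : ~~ squarefree_away Q n ->
  exists p : nat, [/\ prime p, ~~ (p %| Q)%N & (p ^ 2 %| n)%N].
Proof.
move=> /asboolPn nsf; apply: contrapT => nex; apply: nsf => p pp pQ.
by apply/negP => pn; apply: nex; exists p.
Qed.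

Section Moebius.
Context {R : numDomainType}.

Lemma moebius_away_norm (Q d : nat) : `|moebius_away Q d : R| <= 1.
Proof.
rewrite /moebius_away; case: ifP => _; last by rewrite normr0.
by rewrite normrX normrN1 expr1n.
Qed.

Lemma moebius_away_coprime (Q d : nat) :
  moebius_away Q d != 0 :> R -> (0 < d)%N && coprime d Q.
Proof.
rewrite /moebius_away; case: ifP => [/and3P[-> -> _]//|_].
by rewrite eqxx.
Qed.

(** If [p] divides [e] then [p ^ 2] divides [p * e]; otherwise exactly one prime factor is added.
    This sign change drives the cancellation in [sum_moebius_away]. *)
Lemma moebius_away_mul (Q p e : nat) : prime p -> ~~ (p %| Q)%N ->
  moebius_away Q (p * e) = (if (p %| e)%N then 0 else - moebius_away Q e) :> R.
Proof.
move=> pp pQ; rewrite /moebius_away muln_gt0 prime_gt0 //=.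
have [->|e0] := posnP e; first by rewrite dvdn0.
have pe_primes : primes (p * e) =i predU1 p (mem (primes e)).
  move=> x; rewrite (primesM _ (prime_gt0 pp) e0) !inE.
  by rewrite primes_prime // inE.
have [pe|pe] := boolP (p %| e)%N.
  case: ifP => // /and3P[_ _ /allP /(_ p)].
  rewrite pe_primes !inE eqxx => /(_ isT).
  by rewrite expnS expn1 dvdn_pmul2l ?prime_gt0 // pe.
rewrite coprimeMl prime_coprime // pQ /=.
have -> : all (fun q => ~~ (q ^ 2 %| p * e)%N) (primes (p * e))
        = all (fun q => ~~ (q ^ 2 %| e)%N) (primes e).
  have peq (q : nat) : q \in primes e -> (q ^ 2 %| p * e)%N = (q ^ 2 %| e)%N.
    rewrite mem_primes => /and3P[pq _ qe]; rewrite Gauss_dvdr //.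
    rewrite coprimeXl // coprime_sym prime_coprime // dvdn_prime2 //.
    by apply: contraNN pe => /eqP ->.
  apply/allP/allP => H q qe.
    by rewrite -peq //; apply: H; rewrite pe_primes !inE qe orbT.
  move: qe; rewrite pe_primes !inE => /orP[/eqP ->|qe].
    by rewrite expnS expn1 dvdn_pmul2l ?prime_gt0.
  by rewrite peq //; apply: H.
have -> : size (primes (p * e)) = (size (primes e)).+1.
  rewrite -[RHS]/(size (p :: primes e)); apply/perm_size/uniq_perm.
  - exact: primes_uniq.
  - by rewrite /= primes_uniq mem_primes !negb_and pe !orbT.
  - by move=> x; rewrite pe_primes !inE.
by case: ifP => _; rewrite ?exprS ?mulN1r ?oppr0.
Qed.

(* A prime [p] violating squarefreeness pairs [e] with [p * e], and the two
   terms cancel. *)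
Lemma sum_moebius_away (Q n D : nat) :
  (0 < n)%N -> (forall d : nat, (d ^ 2 %| n)%N -> (d <= D)%N) ->
  \sum_(d < D.+1 | (d ^ 2 %| n)%N) moebius_away Q d
    = (squarefree_away Q n)%:R :> R.
Proof.
move=> n0 dD; have D1 : (1 < D.+1)%N by rewrite ltnS dD // exp1n dvd1n.
have [/asboolP sf|/squarefree_awayPn[p [pp pQ pn]]] := boolP (squarefree_away Q n).
  (* Only [d = 1] survives: the least prime factor [p] of any other [d] prime to [Q] would have
     [p ^ 2] dividing [n]. *)
  rewrite (bigD1 (Ordinal D1)) /=; last by rewrite exp1n dvd1n.
  rewrite big1 => [|d /andP[dn d1]]; first by rewrite addr0 /moebius_away coprime1n.
  apply: contraTeq dn => /moebius_away_coprime /andP[d0 dQ].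
  have d_neq1 : nat_of_ord d != 1%N by apply: contraNneq d1 => d1; apply/eqP/val_inj.
  have pp : prime (pdiv d) by apply: pdiv_prime; case: (nat_of_ord d) d0 d_neq1 => [|[]].
  apply: contra (sf _ pp _); first by apply: dvdn_trans; rewrite dvdn_exp2r ?pdiv_dvd.
  by rewrite -prime_coprime //; apply: coprime_dvdl dQ; rewrite pdiv_dvd.
pose F (d : nat) : R := if (d ^ 2 %| n)%N then moebius_away Q d else 0.
have F0 : F 0%N = 0 by rewrite /F /moebius_away /= if_same.
have FM (e : nat) : F (p * e)%N = if (p %| e)%N then 0 else - F e.
  rewrite /F moebius_away_mul //; have [pe|pe] := boolP (p %| e)%N.
    by rewrite if_same.
  rewrite expnMn Gauss_dvd ?pn /=; first by case: ifP; rewrite ?oppr0.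
  by rewrite coprimeXl // coprimeXr // prime_coprime.
have FD (d : nat) : F d != 0 -> (d <= D)%N.
  by rewrite /F; case: ifP => [/dD //|_]; rewrite eqxx.
(* [inord] sends an out-of-range [p * e] to 0, which is harmless because [F] vanishes there. *)
have valM (e : 'I_D.+1) :
    nat_of_ord (inord (p * e) : 'I_D.+1) = (if p * e <= D then p * e else 0)%N.
  by rewrite /inord val_insubd ltnS.
rewrite big_mkcond /= (eq_bigr (fun d : 'I_D.+1 => F d)) //.
rewrite (bigID (fun d : 'I_D.+1 => F d != 0)) /=.
rewrite [X in _ + X]big1 ?addr0 => [|d /negbNE/eqP //].
rewrite (bigID (fun d : 'I_D.+1 => p %| d)%N) /=.
(* The nonzero terms at multiples of [p] are reindexed by [d = p * e]. They then range over the same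
   [e] as the nonzero terms prime to [p], with opposite signs. *)
rewrite (reindex_onto (fun e : 'I_D.+1 => inord (p * e))
   (fun d : 'I_D.+1 => inord (d %/ p))) /=; last first.
  move=> d /andP[_ pd]; apply: val_inj.
  rewrite /= !inordK ?(leq_ltn_trans (leq_div _ _)) //.
    by rewrite mulnC divnK.
  by rewrite mulnC divnK.
under eq_bigl => e.
  have -> : [&& (F (inord (p * e) : 'I_D.+1) != 0) && (p %| (inord (p * e) : 'I_D.+1))%N
      & inord ((inord (p * e) : 'I_D.+1) %/ p) == e] = (F e != 0) && ~~ (p %| e)%N.
  rewrite !valM; case: leqP => peD.
    rewrite FM dvdn_mulr //= mulKn ?prime_gt0 // inord_val eqxx.
    by case: (p %| e)%N; rewrite ?eqxx ?oppr_eq0 ?andbF ?andbT.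
  rewrite F0 eqxx /=; apply/esym/negP => /andP[Fe /negPf pe].
  by have := FD (p * e)%N; rewrite FM pe oppr_eq0 => /(_ Fe); rewrite leqNgt peD.
  over.
rewrite -big_split /= big1 // => e /andP[Fe /negPf pe].
have peD : (p * e <= D)%N by apply: FD; rewrite FM pe oppr_eq0.
by rewrite valM peD FM pe addNr.
Qed.

End Moebius.

Section LinearForm.
Local Open Scope nat_scope.
Variables (a : nat) (b : int).

Definition linear_form (y : nat) : nat := `|((a * y)%N%:Z + b)%R|%N.

Lemma dvdn_linear_form (d y : nat) :
  (d %| linear_form y) = (d%:Z %| ((a * y)%N%:Z + b)%R)%Z.
Proof. by rewrite dvdzE. Qed.

Lemma linear_form_periodic (d m y : nat) : d %| m ->
  (d %| linear_form (y + m)) = (d %| linear_form y).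
Proof.
move=> dm; rewrite !dvdn_linear_form mulnDr PoszD addrAC.
by rewrite rpredDr // dvdzE /= dvdn_mull.
Qed.

Lemma linear_form_separated (d y z : nat) : coprime d a ->
  d %| linear_form y -> d %| linear_form z -> y = z %[mod d].
Proof.
rewrite !dvdn_linear_form => da dy dz.
have : (d%:Z %| (a%:Z * (y%:Z - z%:Z))%R)%Z.
  have -> : (a%:Z * (y%:Z - z%:Z) = (a * y)%N%:Z + b - ((a * z)%N%:Z + b) :> int)%R.
    by rewrite !PoszM; ring.
  by rewrite rpredB.
rewrite Gauss_dvdzr; last by rewrite /coprimez /gcdz /= eqz_nat.
by rewrite -eqz_mod_dvd !modz_nat eqz_nat => /eqP.
Qed.

Lemma linear_form_root (d : nat) : 0 < d -> coprime d a ->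
  exists y, d %| linear_form y.
Proof.
move=> d0 da.
have d0z : d%:Z != 0%R by rewrite eqz_nat -lt0n.
have /coprimezP [[u v] /= uv] : coprimez d%:Z a%:Z by [].
(* Bezout's identity [u * d + v * a = 1] makes [- b * v] a root; reducing it modulo [d] gives a
   nonnegative one. *)
pose q := ((- b * v)%R %/ d%:Z)%Z; pose r := ((- b * v)%R %% d%:Z)%Z.
have qr : (- b * v = q * d%:Z + r)%R := divz_eq (- b * v)%R d%:Z.
exists `|r|%N; rewrite dvdn_linear_form PoszM gez0_abs ?modz_ge0 //.
have -> : (a%:Z * r + b = d%:Z * (b * u - a%:Z * q))%R.
  have -> : (r = - b * v - q * d%:Z)%R by rewrite qr; ring.
  rewrite -{2}[b]mulr1 -uv; ring.
by rewrite dvdz_mulr.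
Qed.

End LinearForm.

(** * The sieve *)

Section InverseSquares.
Context {R : realFieldType}.

(** Telescoping of [1 / d^2 <= 1 / (d - 1) - 1 / d]. *)
Lemma sum_inv_sq_tail (w H : nat) : (0 < w)%N ->
  \sum_(w.+1 <= d < H.+1) (d ^ 2)%:R^-1 <= w%:R^-1 :> R.
Proof.
move=> w0; have [Hw|wH] := leqP H w.
  by rewrite big_geq ?invr_ge0 // ltnS.
have w0R : 0 < w%:R :> R by rewrite ltr0n.
apply: (@le_trans _ _ (w%:R^-1 - H%:R^-1)); last first.
  by rewrite gerBl invr_ge0.
have -> : w%:R^-1 - H%:R^-1 =
    \sum_(w.+1 <= d < H.+1) (- d%:R^-1 - - d.-1%:R^-1) :> R.
  rewrite (telescope_sumr_eq (fun d => - d.-1%:R^-1)) /=.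
  - by rewrite opprK addrC.
  - by rewrite ltnS ltnW.
  - by move=> k _.
rewrite big_nat [leRHS]big_nat; apply: ler_sum => d /andP[wd _].
have d1 : (0 < d.-1)%N by case: d wd => [|[|d]] //; case: w w0 {wH w0R}.
have -> : d = d.-1.+1 by rewrite prednK // (leq_ltn_trans _ wd).
move: d1; rewrite succnK; move: d.-1 => e e0.
have e0R : 0 < e%:R :> R by rewrite ltr0n.
rewrite natrX -natr1.
have e1R : 0 < e%:R + 1 :> R by rewrite addr_gt0.
rewrite -subr_ge0.
have -> : - (e%:R + 1)^-1 - - e%:R^-1 - (e%:R + 1) ^- 2
        = (e%:R * (e%:R + 1) ^+ 2)^-1 :> R.
  by field; rewrite !gt_eqF.
by rewrite invr_ge0 mulr_ge0 ?exprn_ge0 ?ltW.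
Qed.

Lemma sum_inv_sq_le2 (G : nat) :
  \sum_(0 <= d < G.+1) (d ^ 2)%:R^-1 <= 2 :> R.
Proof.
have [G0|G0] := posnP G; first by rewrite G0 big_nat1 exp0n // invr0.
(* The terms at 0 and 1 are split off; the first is 0, since the inverse of 0 is 0. *)
rewrite (big_cat_nat (n := 2)) //= /index_iota /= !big_cons big_nil.
rewrite exp0n // exp1n invr0 invr1 add0r addr0.
rewrite (_ : 2 = 1 + 1) // lerD2l.
by have := sum_inv_sq_tail 1 G isT; rewrite invr1.
Qed.

(** Each [d] is hit at most [N / d^2 + 1] times: the first part sums to at most [N / w], the second
    to at most [H]. This bounds every discarded tail of large [d]. *)
Lemma sum_count_separated_squares (c : pred nat) (P : nat -> pred nat)
    (w H s N : nat) : (0 < w)%N ->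
  (forall d y z, c d -> P d y -> P d z -> y = z %[mod d ^ 2]) ->
  \sum_(w.+1 <= d < H.+1 | c d) (count (P d) (iota s N))%:R
    <= N%:R / w%:R + H%:R :> R.
Proof.
move=> w0 Psep.
apply: (@le_trans _ _ (\sum_(w.+1 <= d < H.+1) (N%:R * (d ^ 2)%:R^-1 + 1))).
  rewrite big_mkcond big_nat [leRHS]big_nat; apply: ler_sum => d /andP[wd _].
  case: ifPn => cd; last by rewrite addr_ge0 ?mulr_ge0 ?invr_ge0.
  apply: count_separated_le => [|y z]; last exact: Psep.
  by rewrite expn_gt0 (leq_ltn_trans _ wd).
rewrite big_split /= -mulr_sumr lerD ?ler_wpM2l ?sum_inv_sq_tail //.
by rewrite sumr_const_nat ler_nat subSS leq_subr.
Qed.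

End InverseSquares.

Lemma count_sumr (R : pzSemiRingType) (P : pred nat) (r : seq nat) :
  (count P r)%:R = \sum_(y <- r) (P y)%:R :> R.
Proof.
by rewrite -sum1_count natr_sum big_mkcond; apply: eq_bigr => y _; case: (P y).
Qed.

Section Sieve.
Context {R : realFieldType}.
(** In the application [a = alpha * beta0], [b = beta], [K = alpha0 * beta0] and
    [Q2 = alpha * |beta| * gamma]. Divisibility of [Q2] by [a] makes the linear form invertible
    modulo [d ^ 2] for [d] prime to [Q2]; divisibility by [b] prevents such a [d] from sharing a
    prime with both [y] and [g y]. *)
Variables (a : nat) (b : int) (gamma K rho Q2 : nat).
Let Q1 := (K * gamma)%N.
Hypotheses (a_gt0 : (0 < a)%N) (gamma_gt0 : (0 < gamma)%N) (K_gt0 : (0 < K)%N).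
Hypothesis K_gamma : coprime K gamma.
Hypotheses (Q1_dvd : (Q1 %| Q2)%N) (a_dvd : (a %| Q2)%N) (b_dvd : (`|b| %| Q2)%N).

Local Notation g := (linear_form a b).

Definition sieve_base (y : nat) : bool :=
  (y == rho %[mod gamma ^ 2]) && coprime y K.

Definition sieved (y : nat) : bool :=
  [&& sieve_base y, squarefree_away Q1 y & squarefree_away Q2 (g y)].

Definition twice_divisible (d1 d2 y : nat) : bool :=
  [&& sieve_base y, (d1 ^ 2 %| y)%N & (d2 ^ 2 %| g y)%N].

(** A common multiple of all the moduli involved. With [K] as outer factor, a period is cut into [K]
    windows, each meeting the set at most once when [d1] and [d2] are admissible. *)
Definition twice_period (d1 d2 : nat) : nat :=
  (K * (gamma ^ 2 * (d1 ^ 2 * d2 ^ 2)))%N.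

Definition twice_density (d1 d2 : nat) : R :=
  (count (twice_divisible d1 d2) (iota 0 (twice_period d1 d2)))%:R
    / (twice_period d1 d2)%:R.

Definition sieve_coef (d1 d2 : nat) : R :=
  moebius_away Q1 d1 * moebius_away Q2 d2 * twice_density d1 d2.

(** A partial sum of the absolutely convergent double series for the density of [sieved]. *)
Definition truncated_density (G w : nat) : R :=
  \sum_(0 <= d1 < G.+1) \sum_(0 <= d2 < w.+1) sieve_coef d1 d2.

Lemma linear_form_separated_sq (d y z : nat) : coprime d Q2 ->
  (d ^ 2 %| g y)%N -> (d ^ 2 %| g z)%N -> y = z %[mod d ^ 2].
Proof.
move=> dQ; apply: linear_form_separated.
by rewrite coprimeXl // (coprime_dvdr a_dvd).
Qed.

Lemma sieve_base_periodic (m y : nat) : (K %| m)%N -> (gamma ^ 2 %| m)%N ->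
  sieve_base (y + m) = sieve_base y.
Proof.
move=> /dvdnP[k ->] gm; rewrite /sieve_base addnC; congr (_ && _).
  by rewrite -modnDml (eqP gm) add0n.
by rewrite /coprime gcdnC gcdnMDl gcdnC.
Qed.

Lemma twice_divisible_periodic (d1 d2 y : nat) :
  twice_divisible d1 d2 (y + twice_period d1 d2) = twice_divisible d1 d2 y.
Proof.
have Km : (K %| twice_period d1 d2)%N by exact: dvdn_mulr.
have gm : (gamma ^ 2 %| twice_period d1 d2)%N by apply/dvdn_mull/dvdn_mulr.
have m1 : (d1 ^ 2 %| twice_period d1 d2)%N by apply/dvdn_mull/dvdn_mull/dvdn_mulr.
have m2 : (d2 ^ 2 %| twice_period d1 d2)%N by do 3!apply: dvdn_mull.
by rewrite /twice_divisible sieve_base_periodic // dvdn_addl // linear_form_periodic.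
Qed.

(* [y] is pinned down modulo [gamma ^ 2], [d1 ^ 2] and [d2 ^ 2]; a common prime
   factor of [d1] and [d2] would divide [b]. *)
Lemma twice_divisible_count (d1 d2 : nat) :
  (0 < d1)%N -> (0 < d2)%N -> coprime d1 Q1 -> coprime d2 Q2 ->
  (count (twice_divisible d1 d2) (iota 0 (twice_period d1 d2)) <= K)%N.
Proof.
move=> d1_gt0 d2_gt0 c1 c2; apply: count_separated_windows => [|y z].
  by rewrite !muln_gt0 gamma_gt0 d1_gt0 d2_gt0.
have cg1 : coprime (gamma ^ 2) (d1 ^ 2).
  by rewrite coprimeXl // coprimeXr // coprime_sym (coprime_dvdr _ c1) // dvdn_mull.
have cg2 : coprime (gamma ^ 2) (d2 ^ 2).
  rewrite coprimeXl // coprimeXr // coprime_sym (coprime_dvdr _ c2) //.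
  by apply: dvdn_trans Q1_dvd; rewrite dvdn_mull.
move=> /and3P[/andP[/eqP yr _] y1 y2] /and3P[/andP[/eqP zr _] z1 z2].
have c12 : coprime (d1 ^ 2) (d2 ^ 2).
  rewrite coprimeXl // coprimeXr // coprime_sym.
  apply/eqP; apply: contraTeq c2 => g1.
  have gd : (1 < gcdn d2 d1)%N 
    by case: (gcdn _ _) (gcdn_gt0 d2 d1) g1 => [|[|n]] //; rewrite d2_gt0.
  have pp := pdiv_prime gd; set p := pdiv _ in pp.
  have p2 : (p %| d2)%N by rewrite (dvdn_trans (pdiv_dvd _)) ?dvdn_gcdl.
  have p1 : (p %| d1)%N by rewrite (dvdn_trans (pdiv_dvd _)) ?dvdn_gcdr.
  have pQ : (p %| Q2)%N.
    apply: dvdn_trans b_dvd.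
    have py : (p %| y)%N by rewrite (dvdn_trans p1) // (dvdn_trans _ y1) // dvdn_exp.
    have : (p %| g y)%N by rewrite (dvdn_trans p2) // (dvdn_trans _ y2) // dvdn_exp.
    by rewrite dvdn_linear_form rpredDl dvdzE // dvdn_mull.
  apply/negP => /(coprime_dvdl p2)/(coprime_dvdr pQ).
  by rewrite prime_coprime // dvdnn.
have cg12 : coprime (gamma ^ 2) (d1 ^ 2 * d2 ^ 2) by rewrite coprimeMr cg1.
apply/eqP; rewrite (chinese_remainder cg12) (chinese_remainder c12) yr zr eqxx /=.
rewrite (eqP y1) (eqP z1) eqxx /=.
by apply/eqP/linear_form_separated_sq.
Qed.

Lemma twice_period_gt0 (d1 d2 : nat) : (0 < d1)%N -> (0 < d2)%N ->
  (0 < twice_period d1 d2)%N.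
Proof.
by move=> d1_gt0 d2_gt0; rewrite !muln_gt0 gamma_gt0 d1_gt0 d2_gt0 K_gt0.
Qed.

(** Where the Moebius weights do not vanish, at most [K] hits occur in a period of length
    [K * gamma^2 * d1^2 * d2^2]. *)
Lemma sieve_coef_norm (d1 d2 : nat) :
  `|sieve_coef d1 d2| <= (d1 ^ 2)%:R^-1 * (d2 ^ 2)%:R^-1.
Proof.
have rhs0 : 0 <= (d1 ^ 2)%:R^-1 * (d2 ^ 2)%:R^-1 :> R.
  by rewrite mulr_ge0 ?invr_ge0.
rewrite /sieve_coef.
have [->|n1] := eqVneq (moebius_away Q1 d1 : R) 0; first by rewrite !mul0r normr0.
have [->|n2] := eqVneq (moebius_away Q2 d2 : R) 0.
  by rewrite mulr0 mul0r normr0.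
have /andP[d1_gt0 c1] := moebius_away_coprime _ _ n1.
have /andP[d2_gt0 c2] := moebius_away_coprime _ _ n2.
have dens0 : 0 <= twice_density d1 d2 by rewrite divr_ge0.
rewrite normrM [`|_ * moebius_away _ _|]normrM (ger0_norm dens0) -[leRHS]mul1r.
apply: ler_pM; [exact: mulr_ge0|exact: dens0| |].
  by rewrite -[leRHS]mul1r ler_pM // moebius_away_norm.
rewrite /twice_density ler_pdivrMr ?ltr0n ?twice_period_gt0 //.
have -> : (twice_period d1 d2)%:R
    = K%:R * ((gamma ^ 2)%:R * ((d1 ^ 2)%:R * (d2 ^ 2)%:R)) :> R.
  by rewrite -!natrM.
have e1 : (d1 ^ 2)%:R != 0 :> R by rewrite pnatr_eq0 -lt0n expn_gt0 d1_gt0.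
have e2 : (d2 ^ 2)%:R != 0 :> R by rewrite pnatr_eq0 -lt0n expn_gt0 d2_gt0.
have -> : (d1 ^ 2)%:R^-1 / (d2 ^ 2)%:R
    * (K%:R * ((gamma ^ 2)%:R * ((d1 ^ 2)%:R * (d2 ^ 2)%:R)))
    = (K * gamma ^ 2)%:R :> R.
  rewrite natrM; move: e1 e2; move: (d1 ^ 2)%:R (d2 ^ 2)%:R (gamma ^ 2)%:R => u v c.
  by move=> u0 v0; field; rewrite u0 v0.
rewrite ler_nat (leq_trans (twice_divisible_count _ _ _ _ _ _)) //.
by rewrite leq_pmulr // expn_gt0 gamma_gt0.
Qed.

(** The new pairs have either [d1 > G], or [d1 <= G] and [d2 > w]. In each case one variable gives a
    tail of inverse squares and the other a sum at most 2. *)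
Lemma truncated_density_cauchy (G w G' w' : nat) :
  (0 < G)%N -> (0 < w)%N -> (G <= G')%N -> (w <= w')%N ->
  `|truncated_density G' w' - truncated_density G w| <= 2 / G%:R + 2 / w%:R.
Proof.
move=> G0 w0 GG ww; rewrite /truncated_density.
rewrite (big_cat_nat (n := G.+1)) //=.
rewrite addrAC -sumrB.
rewrite addrC [X in _ + X](eq_bigr
  (fun d1 => \sum_(w.+1 <= d2 < w'.+1) sieve_coef d1 d2)); last first.
  by move=> d1 _; rewrite (big_cat_nat (n := w.+1)) //= addrAC subrr add0r.
apply: le_trans (ler_normD _ _) _; apply: lerD.
  apply: le_trans (ler_norm_sum _ _ _) _.
  apply: (@le_trans _ _ (\sum_(G.+1 <= d1 < G'.+1) ((d1 ^ 2)%:R^-1 * 2))).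
    apply: ler_sum => d1 _; apply: le_trans (ler_norm_sum _ _ _) _.
    apply: le_trans (ler_sum _ (fun d2 _ => sieve_coef_norm d1 d2)) _.
    by rewrite -mulr_sumr ler_wpM2l ?invr_ge0 ?sum_inv_sq_le2.
  by rewrite -mulr_suml mulrC ler_wpM2l ?sum_inv_sq_tail.
apply: le_trans (ler_norm_sum _ _ _) _.
apply: (@le_trans _ _ (\sum_(0 <= d1 < G.+1) ((d1 ^ 2)%:R^-1 * w%:R^-1))).
  apply: ler_sum => d1 _; apply: le_trans (ler_norm_sum _ _ _) _.
  apply: le_trans (ler_sum _ (fun d2 _ => sieve_coef_norm d1 d2)) _.
  by rewrite -mulr_sumr ler_wpM2l ?invr_ge0 ?sum_inv_sq_tail.
by rewrite -mulr_suml ler_wpM2r ?invr_ge0 ?sum_inv_sq_le2.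
Qed.

Lemma linear_form_gt0 (y : nat) : (`|b| < y)%N -> (0 < g y)%N.
Proof.
have := leq_pmull y a_gt0; rewrite /linear_form; move: (a * y)%N => ay; lia.
Qed.

Lemma linear_form_le (y : nat) : (g y <= a * y + `|b|)%N.
Proof. by rewrite /linear_form; move: (a * y)%N => ay; lia. Qed.

(** * Sieve estimates in one window *)

Section Window.
Variables (s N w H : nat).
(** Starting beyond [|b|] keeps [g y] nonzero. [H_large] makes [H] an upper bound for every [d]
    whose square divides [y] or [g y] in the window, so Moebius sums up to [H] are complete. *)
Hypotheses (s_gt : (`|b| < s)%N) (w_gt0 : (0 < w)%N) (w_le_H : (w <= H)%N).
Hypothesis H_large : (a * (s + N) + `|b| < H.+1 ^ 2)%N.

Lemma sq_dvd_bound (d n : nat) :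
  (0 < n)%N -> (n <= a * (s + N) + `|b|)%N -> (d ^ 2 %| n)%N -> (d <= H)%N.
Proof.
move=> n0 nle /dvdn_leq -/(_ n0) dn; rewrite -ltnS -(ltn_exp2r _ _ (e := 2)) //.
exact: leq_ltn_trans dn (leq_ltn_trans nle H_large).
Qed.

Lemma sq_dvd_window (d y : nat) :
  y \in iota s N -> (d ^ 2 %| y)%N -> (d <= H)%N.
Proof.
rewrite mem_iota => /andP[sy yN]; apply: sq_dvd_bound; first by lia.
apply: (@leq_trans (a * (s + N))); last exact: leq_addr.
by rewrite (leq_trans (ltnW yN)) // leq_pmull.
Qed.

Lemma sq_dvd_linear_form (d y : nat) :
  y \in iota s N -> (d ^ 2 %| g y)%N -> (d <= H)%N.
Proof.
rewrite mem_iota => /andP[sy yN]; apply: sq_dvd_bound.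
  by apply: linear_form_gt0; apply: leq_trans sy.
by apply: leq_trans (linear_form_le y) _; rewrite leq_add2r leq_mul2l ltnW ?orbT.
Qed.

Lemma sum_moebius_linear_form (y : nat) : y \in iota s N ->
  \sum_(0 <= d < H.+1 | (d ^ 2 %| g y)%N) moebius_away Q2 d
    = (squarefree_away Q2 (g y))%:R :> R.
Proof.
move=> yN; rewrite big_mkord sum_moebius_away //.
  by apply: linear_form_gt0; move: yN; rewrite mem_iota => /andP[/(leq_trans s_gt)].
by move=> d; apply: sq_dvd_linear_form.
Qed.

Lemma sum_moebius_window (y : nat) : y \in iota s N ->
  \sum_(0 <= d < H.+1 | (d ^ 2 %| y)%N) moebius_away Q1 d
    = (squarefree_away Q1 y)%:R :> R.
Proof.
move=> yN; rewrite big_mkord sum_moebius_away //.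
  by move: yN; rewrite mem_iota => /andP[sy _]; apply: leq_trans sy; lia.
by move=> d; apply: sq_dvd_window.
Qed.

Let A (y : nat) : R := (sieve_base y && squarefree_away Q1 y)%:R.
Let T (y : nat) : R :=
  \sum_(0 <= d < w.+1 | (d ^ 2 %| g y)%N) moebius_away Q2 d.

(** The omitted Moebius terms number at most the pairs [(d, y)] with [d > w], [d] prime to [Q2] and
    [d ^ 2] dividing [g y]. *)
Lemma sieved_truncate :
  `|(count sieved (iota s N))%:R - \sum_(y <- iota s N) A y * T y|
    <= N%:R / w%:R + H%:R :> R.
Proof.
apply: le_trans (sum_count_separated_squares (fun d => coprime d Q2)
  (fun d y => d ^ 2 %| g y)%N w H s N w_gt0 linear_form_separated_sq).
under [leRHS]eq_bigr => d _ do rewrite count_sumr.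
rewrite exchange_big /= count_sumr -sumrB.
apply: le_trans (ler_norm_sum _ _ _) _.
rewrite big_seq [leRHS]big_seq; apply: ler_sum => y yN.
have -> : (sieved y)%:R = A y * (squarefree_away Q2 (g y))%:R.
  by rewrite /A -natrM mulnb -andbA.
rewrite -(sum_moebius_linear_form y yN) (big_cat_nat (n := w.+1)) //=.
rewrite -mulrBr /T addrAC subrr add0r normrM.
have A1 : `|A y| <= 1 by rewrite /A; case: (_ && _); rewrite ?normr1 ?normr0.
apply: le_trans (ler_piMl (normr_ge0 _) A1) _.
apply: le_trans (ler_norm_sum _ _ _) _.
rewrite big_mkcond [leRHS]big_mkcond; apply: ler_sum => d _.
case: ifPn => dg; last by case: ifP.
case: ifPn => [_|nc]; first exact: moebius_away_norm.
rewrite [moebius_away Q2 d](_ : _ = 0) ?normr0 //; apply/eqP.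
by apply: contraNT nc => /moebius_away_coprime/andP[].
Qed.

(** After expanding both Moebius sums and exchanging the order, each of the [(H + 1) * (w + 1)]
    pairs counts a periodic set with at most [K] hits per period, hence errs by at most [K]. *)
Lemma truncate_density :
  `|\sum_(y <- iota s N) A y * T y - N%:R * truncated_density H w|
    <= K%:R * (H.+1)%:R * (w.+1)%:R.
Proof.
have -> : \sum_(y <- iota s N) A y * T y = \sum_(0 <= d1 < H.+1)
    \sum_(0 <= d2 < w.+1) moebius_away Q1 d1 * moebius_away Q2 d2
      * (count (twice_divisible d1 d2) (iota s N))%:R.
  under [RHS]eq_bigr => d1 _.
    under eq_bigr => d2 _ do rewrite count_sumr mulr_sumr.
    rewrite exchange_big /=.
    over.
  rewrite exchange_big /= big_seq [RHS]big_seq; apply: eq_bigr => y yN.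
  rewrite /A -mulnb natrM -(sum_moebius_window y yN) /T.
  rewrite -mulrA big_distrlr /= big_distrr /= big_mkcond /=; apply: eq_bigr => d1 _.
  rewrite /twice_divisible.
  case: (d1 ^ 2 %| y)%N; last first.
    by rewrite big1 // => d2 _; rewrite andbF mulr0.
  rewrite big_distrr /= big_mkcond; apply: eq_bigr => d2 _.
  by case: (d2 ^ 2 %| _)%N; rewrite ?andbF ?andbT ?mulr0 // mulrC.
rewrite /truncated_density mulr_sumr -sumrB.
apply: le_trans (ler_norm_sum _ _ _) _.
apply: (@le_trans _ _ (\sum_(0 <= d1 < H.+1) \sum_(0 <= d2 < w.+1) K%:R)); last first.
  by rewrite !sumr_const_nat !subn0 -[leLHS]mulr_natr -[K%:R *+ _]mulr_natr mulrAC.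
apply: ler_sum => d1 _; rewrite mulr_sumr -sumrB.
apply: le_trans (ler_norm_sum _ _ _) _; apply: ler_sum => d2 _.
rewrite /sieve_coef mulrCA -mulrBr.
have [->|n1] := eqVneq (moebius_away Q1 d1 : R) 0; first by rewrite !mul0r normr0.
have [->|n2] := eqVneq (moebius_away Q2 d2 : R) 0.
  by rewrite mulr0 mul0r normr0.
have /andP[d1_gt0 c1] := moebius_away_coprime _ _ n1.
have /andP[d2_gt0 c2] := moebius_away_coprime _ _ n2.
rewrite normrM -[leRHS]mul1r; apply: ler_pM => //.
  by rewrite normrM -[leRHS]mul1r ler_pM // moebius_away_norm.
rewrite /twice_density.
apply: le_trans (count_periodic_approx _ _ _ (twice_divisible_periodic d1 d2) R s N) _.
  exact: twice_period_gt0.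
by rewrite ler_nat twice_divisible_count.
Qed.

Lemma sieved_truncated_density :
  `|(count sieved (iota s N))%:R - N%:R * truncated_density H w|
    <= N%:R / w%:R + H%:R + K%:R * (H.+1)%:R * (w.+1)%:R.
Proof.
apply: le_trans (ler_distD (\sum_(y <- iota s N) A y * T y) _ _) _.
exact: lerD sieved_truncate truncate_density.
Qed.

(** * Sieving by finitely many primes *)

Definition locally_sieved (p y : nat) : bool :=
  ~~ (p ^ 2 %| y)%N && ((p %| Q2)%N || ~~ (p ^ 2 %| g y)%N).

Definition sieving_primes (z : nat) : seq nat :=
  [seq p <- iota 0 z | prime p && ~~ (p %| Q1)%N].

Definition presieved (z y : nat) : bool :=
  sieve_base y && all (locally_sieved^~ y) (sieving_primes z).

(** A [y] that is presieved but not sieved has a prime [p > w] with [p ^ 2] dividing [y] or [g y].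
    The two tails of large [d] bound the number of such [y]. *)
Lemma sieved_presieved :
  `|(count sieved (iota s N))%:R - (count (presieved w.+1) (iota s N))%:R|
    <= 2 * (N%:R / w%:R + H%:R) :> R.
Proof.
have away1 p y z : coprime p Q1 -> (p ^ 2 %| y)%N -> (p ^ 2 %| z)%N ->
    y = z %[mod p ^ 2] by move=> _ /eqP -> /eqP ->.
have tail1 := sum_count_separated_squares (R := R) (fun d => coprime d Q1)
  (fun d y => d ^ 2 %| y)%N w H s N w_gt0 away1.
have tail2 := sum_count_separated_squares (R := R) (fun d => coprime d Q2)
  (fun d y => d ^ 2 %| g y)%N w H s N w_gt0 linear_form_separated_sq.
rewrite mulr_natl mulr2n; apply: le_trans (lerD tail1 tail2).
under [X in _ <= X + _]eq_bigr => d _ do rewrite count_sumr.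
under [X in _ <= _ + X]eq_bigr => d _ do rewrite count_sumr.
rewrite exchange_big [X in _ <= _ + X]exchange_big /= -big_split /=.
rewrite !count_sumr -sumrB.
apply: le_trans (ler_norm_sum _ _ _) _.
rewrite big_seq [leRHS]big_seq; apply: ler_sum => y yN.
set S1 := \sum_(_ <= _ < _ | _) _; set S2 := \sum_(_ <= _ < _ | _) _.
have S1_ge0 : 0 <= S1 by rewrite sumr_ge0.
have S2_ge0 : 0 <= S2 by rewrite sumr_ge0.
have member (c q : pred nat) (p : nat) : c p -> q p -> (w < p <= H)%N ->
    1 <= \sum_(w.+1 <= d < H.+1 | c d) (q d)%:R :> R.
  move=> cp qp /andP[wp pH].
  rewrite big_mkcond (bigD1_seq p) ?mem_index_iota ?iota_uniq ?wp //=.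
  by rewrite cp qp lerDl sumr_ge0 // => d _; case: (c d).
have [sv|/negP nsv] := boolP (sieved y).
  suff -> : presieved w.+1 y by rewrite subrr normr0 addr_ge0.
  case/and3P: sv => By /asboolP sf1 /asboolP sf2; rewrite /presieved By /=.
  apply/allP => p; rewrite mem_filter => /andP[/andP[pp pQ] _].
  rewrite /locally_sieved sf1 //=; have [//|pQ2] := boolP (p %| Q2)%N.
  exact: sf2.
have [psv|] := boolP (presieved w.+1 y); last by rewrite subrr normr0 addr_ge0.
rewrite sub0r normrN normr1.
case/andP: psv => By /allP ps.
have big_p p : prime p -> ~~ (p %| Q1)%N -> ~~ locally_sieved p y -> (w < p)%N.
  move=> pp pQ npl; rewrite ltnNge; apply: contraNN npl => pw.
  by apply: ps; rewrite mem_filter pp pQ mem_iota /= add0n ltnS.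
have [sf1|nsf1] := boolP (squarefree_away Q1 y); last first.
  have [p [pp pQ py]] := squarefree_awayPn _ _ nsf1.
  rewrite (le_trans (member (fun d => coprime d Q1) (fun d => d ^ 2 %| y)%N p _ _ _)) //.
  - by rewrite prime_coprime.
  - rewrite (sq_dvd_window p y) // andbT; apply: big_p => //.
    by rewrite /locally_sieved py.
  - by rewrite lerDl.
have [sf2|nsf2] := boolP (squarefree_away Q2 (g y)).
  by case: nsv; rewrite /sieved By sf1.
have [p [pp pQ py]] := squarefree_awayPn _ _ nsf2.
rewrite (le_trans (member (fun d => coprime d Q2) (fun d => d ^ 2 %| g y)%N p _ _ _)) //.
- by rewrite prime_coprime.
- rewrite (sq_dvd_linear_form p y) // andbT; apply: big_p => //.
    by apply: contraNN pQ => /dvdn_trans; apply.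
  by rewrite /locally_sieved py (negPf pQ) andbF.
- by rewrite lerDr.
Qed.

End Window.


Definition sieve_period (ps : seq nat) : nat :=
  (gamma ^ 2 * K * \prod_(p <- ps) p ^ 2)%N.

(** Modulo [p ^ 2] the class of 0 is removed and, when [p] does not divide [Q2], also the class of
    the root of [g]; the boolean counts that second class. *)
Definition sieve_density (z : nat) : R :=
  (totient K)%:R / (gamma ^ 2 * K)%:R
    * \prod_(p <- sieving_primes z) (1 - (1 + ~~ (p %| Q2))%N%:R / (p ^ 2)%:R).

Lemma count_eqmod (m r : nat) : (0 < m)%N ->
  count (fun y => y == r %[mod m]) (iota 0 m) = 1%N.
Proof.
move=> m0; transitivity (count_mem (r %% m)%N (iota 0 m)).
  by apply: eq_in_count => y; rewrite mem_iota => /andP[_ ym]; rewrite /= modn_small.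
by rewrite count_uniq_mem ?iota_uniq // mem_iota ltn_mod m0.
Qed.

Lemma sieve_base_count : count sieve_base (iota 0 (gamma ^ 2 * K)) = totient K.
Proof.
rewrite (count_chinese (fun y => y == rho %[mod gamma ^ 2]) (fun y => coprime y K)) //.
- rewrite count_eqmod ?expn_gt0 ?gamma_gt0 // mul1n totient_count_coprime.
  rewrite count_iota_sum big_mkord.
  by apply: eq_bigr => y _; rewrite coprime_sym.
- by rewrite expn_gt0 gamma_gt0.
- by rewrite coprimeXl // coprime_sym.
- by move=> y; rewrite modnDr.
- by move=> y; rewrite /coprime addnC gcdnC gcdnDl gcdnC.
Qed.

Lemma locally_sieved_periodic (p y : nat) :
  locally_sieved p (y + p ^ 2) = locally_sieved p y.
Proof. by rewrite /locally_sieved dvdn_addl // linear_form_periodic. Qed.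

(** The complement is counted. Its two classes are disjoint when [p] does not divide [Q2], since a
    [p] dividing both [y] and [g y] divides [b]. *)
Lemma locally_sieved_count (p : nat) : prime p ->
  (count (locally_sieved p) (iota 0 (p ^ 2)) + (1 + ~~ (p %| Q2)) = p ^ 2)%N.
Proof.
move=> pp; have p2_gt0 : (0 < p ^ 2)%N by rewrite expn_gt0 prime_gt0.
rewrite -[RHS](size_iota 0 (p ^ 2)) -[RHS](count_predC (locally_sieved p)).
congr (_ + _)%N.
have c1 : count (fun y => p ^ 2 %| y)%N (iota 0 (p ^ 2)) = 1%N.
  rewrite -[RHS](count_eqmod (p ^ 2) 0 p2_gt0).
  by apply: eq_count => y; rewrite /= mod0n.
have [pQ|pQ] := boolP (p %| Q2)%N.
  rewrite addn0 -[LHS]c1; apply: eq_count => y.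
  by rewrite /= /locally_sieved pQ andbT negbK.
have cpQ : coprime p Q2 by rewrite prime_coprime.
have pa : coprime (p ^ 2) a by rewrite coprimeXl // (coprime_dvdr a_dvd).
have [y0 y0P] := linear_form_root a b (p ^ 2) p2_gt0 pa.
have c2 : count (fun y => p ^ 2 %| g y)%N (iota 0 (p ^ 2)) = 1%N.
  rewrite -[RHS](count_eqmod (p ^ 2) y0 p2_gt0); apply: eq_count => y /=.
  apply/idP/eqP => [yP|]; first exact: linear_form_separated_sq cpQ yP y0P.
  move=> /(periodic_eqmod (fun y => p ^ 2 %| g y)%N) -> // z.
  exact: linear_form_periodic.
rewrite -[in LHS]c1 -[X in (_ + X)%N]c2 -count_predUI.
rewrite [X in (_ + X)%N](_ : _ = 0%N) ?addn0.
  by apply: eq_count => y /=; rewrite /locally_sieved (negPf pQ) negb_and !negbK.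
apply/eqP; rewrite -leqn0 leqNgt -has_count; apply/hasPn => y _ /=.
apply: contra pQ => /andP[py pgy]; apply: dvdn_trans b_dvd.
have {}py : (p %| y)%N by apply: dvdn_trans py; rewrite dvdn_exp.
have : (p %| g y)%N by apply: dvdn_trans pgy; rewrite dvdn_exp.
by rewrite dvdn_linear_form rpredDl dvdzE // dvdn_mull.
Qed.

Lemma presieved_periodic (ps : seq nat) (y : nat) :
  sieve_base (y + sieve_period ps) && all (locally_sieved^~ (y + sieve_period ps)%N) ps
  = sieve_base y && all (locally_sieved^~ y) ps.
Proof.
have per : (gamma ^ 2 * K %| sieve_period ps)%N by exact: dvdn_mulr.
rewrite sieve_base_periodic; last 2 first.
- exact: dvdn_trans (dvdn_mull _ (dvdnn _)) per.
- exact: dvdn_trans (dvdn_mulr _ (dvdnn _)) per.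
congr (_ && _); apply: eq_in_all => p pps.
have /dvdnP[k ->] : (p ^ 2 %| sieve_period ps)%N.
  by apply: dvdn_mull; rewrite (big_rem p) //= dvdn_mulr.
elim: k => [|k IH]; first by rewrite addn0.
by rewrite mulSn addnCA addnC locally_sieved_periodic.
Qed.

Lemma sieve_period_gt0 (ps : seq nat) : all prime ps -> (0 < sieve_period ps)%N.
Proof.
move=> /allP pps; rewrite /sieve_period !muln_gt0 gamma_gt0 K_gt0 /=.
by rewrite big_seq prodn_cond_gt0 // => p /pps pp; rewrite expn_gt0 prime_gt0.
Qed.

(** Induction on the primes: each [p ^ 2] is coprime to the period built so far, so [count_chinese]
    contributes one Euler factor. *)
Lemma presieved_count (ps : seq nat) : uniq ps ->
  all (fun p => prime p && ~~ (p %| Q1)%N) ps ->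
  (count (fun y => sieve_base y && all (locally_sieved^~ y) ps)
     (iota 0 (sieve_period ps)))%:R / (sieve_period ps)%:R
  = (totient K)%:R / (gamma ^ 2 * K)%:R
    * \prod_(p <- ps) (1 - (1 + ~~ (p %| Q2))%N%:R / (p ^ 2)%:R) :> R.
Proof.
elim: ps => [|p ps IH] /=.
  move=> _ _; rewrite big_nil mulr1 /sieve_period big_nil muln1 -sieve_base_count.
  by congr (_%:R / _); apply: eq_count => y; rewrite andbT.
move=> /andP[pps ups] /andP[/andP[pp pQ] aps].
have prime_ps : all prime ps by apply: sub_all aps => q /andP[].
have per : sieve_period (p :: ps) = (p ^ 2 * sieve_period ps)%N.
  by rewrite /sieve_period big_cons mulnCA.
have p2_gt0 : (0 < p ^ 2)%N by rewrite expn_gt0 prime_gt0.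
have m_gt0 := sieve_period_gt0 ps prime_ps.
have cop : coprime (p ^ 2) (sieve_period ps).
  have [pK pg] : coprime p K /\ coprime p gamma.
    by apply/andP; rewrite -coprimeMr prime_coprime.
  rewrite coprimeXl // /sieve_period coprimeMr coprimeMr pK coprimeXr //= big_seq.
  apply: (big_ind (fun m => coprime p m)).
  - exact: coprimen1.
  - by move=> x y cx cy; rewrite coprimeMr cx.
  - move=> q qps; rewrite coprimeXr // prime_coprime // dvdn_prime2 ?(allP prime_ps q) //.
    by move: pps; apply: contraNN => /eqP ->.
rewrite big_cons mulrCA -IH // per.
rewrite (@eq_count _ _ (predI (locally_sieved p)
  (fun y => sieve_base y && all (locally_sieved^~ y) ps))); last first.
  by move=> y /=; rewrite andbCA.
rewrite count_chinese //; last 2 first.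
- exact: locally_sieved_periodic.
- exact: presieved_periodic.
have := locally_sieved_count p pp.
move: (count _ (iota 0 (p ^ 2))) (count _ (iota 0 (sieve_period ps))) => c1 c2 c1E.
rewrite natrM [(_ * sieve_period ps)%:R]natrM.
have -> : c1%:R = (p ^ 2)%:R - (1 + ~~ (p %| Q2))%N%:R :> R.
  by rewrite -[in RHS]c1E natrD addrK.
have : (p ^ 2)%:R != 0 :> R by rewrite pnatr_eq0 -lt0n.
have : (sieve_period ps)%:R != 0 :> R by rewrite pnatr_eq0 -lt0n.
move: (p ^ 2)%:R (sieve_period ps)%:R (_ + _)%:R => u v k v0 u0.
by field; rewrite u0 v0.
Qed.

(** An error of a whole period suffices: it is independent of [N], and the lemma is applied with [N]
    large compared to it. *)
Lemma presieved_approx (z s N : nat) :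
  `|(count (presieved z) (iota s N))%:R - N%:R * sieve_density z|
    <= (sieve_period (sieving_primes z))%:R.
Proof.
have aps : all (fun p => prime p && ~~ (p %| Q1)%N) (sieving_primes z).
  by rewrite filter_all.
have m_gt0 : (0 < sieve_period (sieving_primes z))%N.
  by apply: sieve_period_gt0; apply: sub_all aps => p /andP[].
rewrite /sieve_density -presieved_count ?filter_uniq ?iota_uniq //.
apply: le_trans (count_periodic_approx _ _ _ (presieved_periodic _) R s N) _ => //.
by rewrite ler_nat -[leqRHS](size_iota 0) count_size.
Qed.

(* If [N <= 16 w^4], then [d^2 <= max (y, g y)] forces [d <= window_scale * w^2]
   for all [y] in the window [|b| < y <= |b| + N]. *)
Definition window_scale : nat := (a * (`|b|.+1 + 16) + `|b|)%N.

(** Twice the constant of [sieved_over_N_approx], once for [N] and once for [N'], plus the 4 coming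
    from [truncated_density_cauchy]. *)
Definition sieve_error : nat :=
  (2 * (1 + window_scale + 4 * K * window_scale) + 4)%N.

Local Notation s := `|b|.+1.
Local Notation h := window_scale.
Local Notation V N := ((count sieved (iota s N))%:R : R).

Lemma window_large (w N : nat) : (N <= 16 * w ^ 4)%N -> (0 < w)%N ->
  (a * (s + N) + `|b| < (h * w ^ 2).+1 ^ 2)%N.
Proof.
move=> Nw w0; have w4 : (0 < w ^ 4)%N by rewrite expn_gt0 w0.
have : (a * (s + N) + `|b| <= h * w ^ 4)%N.
  rewrite /h mulnDl -mulnA leq_add ?leq_pmulr //.
  by rewrite leq_mul2l mulnDl leq_add ?orbT ?leq_pmulr.
move/leq_ltn_trans; apply.
apply: (@leq_ltn_trans ((h * w ^ 2) ^ 2)); last by rewrite ltn_exp2r.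
by rewrite expnMn -expnM leq_mul // leq_pmulr // /h; lia.
Qed.

(** With [w] of order [N^(1/4)] and [H = h * w^2], the three errors [N / w], [H] and
    [K * (H + 1) * (w + 1)] are all [O(w^3)], that is [O(N / w)]. *)
Lemma sieved_over_N_approx (w N : nat) : (0 < w)%N -> (w ^ 4 <= N)%N ->
  (N <= 16 * w ^ 4)%N ->
  `|V N / N%:R - truncated_density (h * w ^ 2) w|
    <= (1 + h + 4 * K * h)%N%:R / w%:R.
Proof.
move=> w0 wN Nw; set t := truncated_density _ _.
have h0 : (0 < h)%N by rewrite /h; lia.
have N0 : (0 < N)%N by apply: leq_trans wN; rewrite expn_gt0 w0.
have N0R : 0 < N%:R :> R by rewrite ltr0n.
have w0R : 0 < w%:R :> R by rewrite ltr0n.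
have -> : V N / N%:R - t = (V N - N%:R * t) / N%:R by field; rewrite gt_eqF.
rewrite normrM normfV (ger0_norm (ltW N0R)) ler_pdivrMr //.
have wh : (w <= h * w ^ 2)%N by rewrite expnS mulnCA leq_pmulr // muln_gt0 h0 expn_gt0 w0.
have large := window_large _ _ Nw w0.
apply: le_trans (sieved_truncated_density _ _ _ _ (ltnSn _) w0 wh large) _.
have -> : (1 + h + 4 * K * h)%N%:R / w%:R * N%:R
    = N%:R / w%:R + (h + 4 * K * h)%N%:R * (N%:R / w%:R) :> R.
  by rewrite -addnA natrD; ring.
rewrite -addrA lerD2l.
have w3N : (w ^ 3)%:R <= N%:R / w%:R :> R.
  by rewrite ler_pdivlMr // -natrM ler_nat -expnSr.
apply: (@le_trans _ _ ((h + 4 * K * h)%N%:R * (w ^ 3)%:R)).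
  rewrite -!natrM -natrD ler_nat mulnDl leq_add //.
    by rewrite leq_mul2l leq_pexp2l ?orbT.
  (* The factor 4 absorbs the two successors in [(H + 1) * (w + 1)]. *)
  have a1 : ((h * w ^ 2).+1 <= 2 * (h * w ^ 2))%N.
    by rewrite mul2n -addnn -addn1 leq_add2l muln_gt0 h0 expn_gt0 w0.
  have a2 : (w.+1 <= 2 * w)%N by rewrite mul2n -addnn -addn1 leq_add2l.
  apply: leq_trans (leq_mul (leq_mul (leqnn K) a1) a2) _.
  by rewrite [(w ^ 3)%N]expnSr; apply/eq_leq; ring.
by rewrite ler_wpM2l.
Qed.

(** The comparison passes from [V N / N] to its truncated density, to the one for a much larger
    [N'], to [V N' / N'], and finally to the presieved density. The bound does not involve [N']. *)
Lemma sieved_over_N_density (w N z : nat) : (0 < w)%N -> (w ^ 4 <= N)%N ->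
  (N < w.+1 ^ 4)%N -> (0 < z)%N ->
  `|V N / N%:R - sieve_density z.+1|
    <= sieve_error%:R / w%:R + 3 / z%:R.
Proof.
move=> w0 wN Nw z0; set C1 := (1 + h + 4 * K * h)%N.
have h0 : (0 < h)%N by rewrite /h; lia.
have le16 (v : nat) : (0 < v)%N -> (v.+1 ^ 4 <= 16 * v ^ 4)%N.
  by move=> v0; rewrite -(expnMn 2 v 4) leq_exp2r // mul2n -addnn -addn1 leq_add2l.
pose m := sieve_period (sieving_primes z.+1).
(* This size gives [z * (m + 2 * h * w'^2) <= w'^4 = N'], so the period [m] and the term [2 * H]
   with [H = h * w'^2] together cost at most [N' / z]. *)
pose w' := (w + z * (m + 2 * h))%N; pose N' := (w' ^ 4)%N.
have ww' : (w <= w')%N by rewrite leq_addr.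
have w'0 : (0 < w')%N by apply: leq_trans ww'.
have N'le : (N' <= 16 * w' ^ 4)%N by rewrite leq_pmull.
have H1 := sieved_over_N_approx w N w0 wN (ltnW (leq_trans Nw (le16 w w0))).
have H2 := sieved_over_N_approx w' N' w'0 (leqnn _) N'le.
have H3 : `|truncated_density (h * w' ^ 2) w' - truncated_density (h * w ^ 2) w|
    <= 2 / (h * w ^ 2)%:R + 2 / w%:R.
  apply: truncated_density_cauchy => //; first by rewrite muln_gt0 h0 expn_gt0 w0.
  by rewrite leq_mul2l leq_exp2r ?ww' ?orbT.
have zH : (z <= h * w' ^ 2)%N.
  apply: (@leq_trans w'); last first.
    by rewrite expnS mulnCA leq_pmulr // muln_gt0 h0 expn_gt0 w'0.
  by rewrite /w' -[leqLHS]addn0 addnC leq_add // leq_pmulr // addn_gt0 muln_gt0 h0 orbT.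
have H4 := sieved_presieved _ _ _ _ (ltnSn _) z0 zH (window_large _ _ N'le w'0).
have H5 := presieved_approx z.+1 s N'.
have N'0 : 0 < N'%:R :> R by rewrite ltr0n expn_gt0 w'0.
have z0R : 0 < z%:R :> R by rewrite ltr0n.
have w0R : 0 < w%:R :> R by rewrite ltr0n.
have w'0R : 0 < w'%:R :> R by rewrite ltr0n.
have H6 : `|V N' / N'%:R - sieve_density z.+1| <= 3 / z%:R.
  set D := sieve_density _ in H5 *.
  have -> : V N' / N'%:R - D = (V N' - N'%:R * D) / N'%:R by field; rewrite gt_eqF.
  rewrite normrM normfV (ger0_norm (ltW N'0)) ler_pdivrMr //.
  apply: le_trans (ler_distD (count (presieved z.+1) (iota s N'))%:R _ _) _.
  apply: le_trans (lerD H4 H5) _.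
  have -> : 3 / z%:R * N'%:R = 2 * (N'%:R / z%:R) + N'%:R / z%:R :> R by ring.
  rewrite mulrDr -addrA lerD2l ler_pdivlMr // -natrM -natrD -natrM ler_nat.
  apply: (@leq_trans (z * (m + 2 * h) * w' ^ 2)).
    rewrite mulnC -mulnA leq_mul2l; apply/orP; right.
    by rewrite mulnDl addnC mulnA leq_add // leq_pmulr // expn_gt0 w'0.
  rewrite /N' (expnD w' 2 2) leq_mul2r; apply/orP; right.
  apply: (@leq_trans w'); first exact: leq_addl.
  by rewrite expnS expn1 leq_pmulr.
apply: le_trans (ler_distD (V N' / N'%:R) _ _) _; apply: lerD H6.
apply: le_trans (ler_distD (truncated_density (h * w ^ 2) w) _ _) _.
have -> : sieve_error%:R / w%:R
    = C1%:R / w%:R + (C1%:R / w%:R + (2 / w%:R + 2 / w%:R)) :> R.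
  by rewrite /sieve_error natrD natrM -/C1; ring.
apply: lerD => //; rewrite distrC.
apply: le_trans (ler_distD (truncated_density (h * w' ^ 2) w') _ _) _.
apply: lerD.
  apply: le_trans H2 _; rewrite ler_wpM2l // lef_pV2 ?posrE //.
  by rewrite ler_nat.
apply: le_trans H3 _; rewrite lerD // ler_wpM2l // lef_pV2 ?posrE //.
  by rewrite ler_nat expnS mulnCA leq_pmulr // muln_gt0 h0 expn_gt0 w0.
by rewrite ltr0n muln_gt0 h0 expn_gt0 w0.
Qed.

End Sieve.

(** * The Euler product at 2 *)

Section EulerProduct.
Local Open Scope classical_set_scope.
Context {R : realType}.

(** Partial sums of the series for [zeta 2] with the Euler factors at [ps] removed. The index 0
    contributes nothing, the inverse of 0 being 0. *)
Definition coprime_inv_sq_sum (ps : seq nat) (n : nat) : R :=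
  \sum_(0 <= k < n.+1 | all (fun p => ~~ (p %| k)%N) ps) (k ^ 2)%:R^-1.

Lemma sum_multiples (F : nat -> R) (p n : nat) : (0 < p)%N ->
  \sum_(0 <= k < n.+1 | (p %| k)%N) F k = \sum_(0 <= j < (n %/ p).+1) F (p * j)%N.
Proof.
move=> p_gt0; elim: n => [|n IH].
  by rewrite div0n big_mkcond !big_nat1 dvdn0 muln0.
rewrite big_mkcond big_nat_recr //= -big_mkcond IH divnS //.
case: ifPn => pn; last by rewrite addr0 add0n.
rewrite add1n [RHS]big_nat_recr //=; congr (_ + F _).
by have := divnS n p_gt0; rewrite pn add1n => <-; rewrite mulnC divnK.
Qed.

(** One step of the sieve of Eratosthenes: the multiples of [p] are the [p * j], and primes other
    than [p] divide [p * j] exactly when they divide [j]. *)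
Lemma coprime_inv_sq_sum_cons (p : nat) (ps : seq nat) (n : nat) :
  prime p -> all prime ps -> p \notin ps ->
  coprime_inv_sq_sum (p :: ps) n =
    coprime_inv_sq_sum ps n - (p ^ 2)%:R^-1 * coprime_inv_sq_sum ps (n %/ p).
Proof.
move=> pp /allP pps pnps; rewrite /coprime_inv_sq_sum.
rewrite [X in _ = X - _](bigID (fun k => p %| k)%N) /=.
have -> : \sum_(0 <= k < n.+1 | all (fun q => ~~ (q %| k)%N) ps && (p %| k)%N)
      (k ^ 2)%:R^-1
    = (p ^ 2)%:R^-1
      * \sum_(0 <= j < (n %/ p).+1 | all (fun q => ~~ (q %| j)%N) ps) (j ^ 2)%:R^-1 :> R.
  under eq_bigl => k do rewrite andbC.
  rewrite big_mkcondr sum_multiples ?prime_gt0 // mulr_sumr [RHS]big_mkcond /=.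
  apply: eq_bigr => j _.
  have -> : all (fun q => ~~ (q %| p * j)%N) ps = all (fun q => ~~ (q %| j)%N) ps.
    apply: eq_in_all => q qps; rewrite Euclid_dvdM ?(pps q) // dvdn_prime2 ?(pps q) //.
    by have [qp|//] := eqVneq q p; move: pnps; rewrite -qp qps.
  by case: (all _ ps) => //; rewrite expnMn natrM invfM.
rewrite addrAC subrr add0r; apply: eq_bigl => k.
by rewrite andbC.
Qed.

Lemma coprime_inv_sq_sum_nil (n : nat) :
  coprime_inv_sq_sum [::] n = series (fun k : nat => k.+1%:R `^ (- 2)) n.
Proof.
rewrite /coprime_inv_sq_sum /= big_nat_recl //= expnS mul0n invr0 add0r.
rewrite seriesEnat /=; apply: eq_bigr => k _.
by rewrite powRN powR_mulrn // natrX.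
Qed.

Lemma zeta2_cvg : series (fun k : nat => k.+1%:R `^ (- 2)) @ \oo --> zeta (2 : R).
Proof.
(* [zeta 2] is by definition the limit of this series, so mere convergence is to be shown. *)
apply: nondecreasing_is_cvgn.
  by apply: nondecreasing_series => n _ _; apply: powR_ge0.
by exists 2 => _ [n _ <-]; rewrite -coprime_inv_sq_sum_nil; apply: sum_inv_sq_le2.
Qed.

Lemma coprime_inv_sq_sum_cvg (ps : seq nat) : all prime ps -> uniq ps ->
  coprime_inv_sq_sum ps n @[n --> \oo]
    --> zeta (2 : R) * \prod_(p <- ps) (1 - 1 / p%:R ^+ 2).
Proof.
elim: ps => [|p ps IH] /=.
  move=> _ _; rewrite big_nil mulr1.
  have -> : coprime_inv_sq_sum [::] = series (fun k : nat => k.+1%:R `^ (- 2)).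
    by apply/funext => n; exact: coprime_inv_sq_sum_nil.
  exact: zeta2_cvg.
move=> /andP[pp pps] /andP[pnps ups].
have {}IH := IH pps ups.
rewrite big_cons mulrCA; set l := zeta _ * _ in IH *.
have -> : (1 - 1 / p%:R ^+ 2) * l = l - (p ^ 2)%:R^-1 * l.
  by rewrite natrX div1r mulrBl mul1r.
under eq_fun => n do rewrite coprime_inv_sq_sum_cons //.
apply: cvgB => //; apply: cvgM; first exact: cvg_cst.
have := cvg_divnr p (prime_gt0 pp).
by move=> /cvg_comp; apply.
Qed.

(** Once the primes up to [z] are removed, only 1 and integers above [z] remain, and the latter
    contribute at most [1 / z]. *)
Lemma zeta2_prime_prod_bounds (z : nat) : (0 < z)%N ->
  1 <= zeta (2 : R) * \prod_(0 <= p < z.+1 | prime p) (1 - 1 / p%:R ^+ 2)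
    <= 1 + z%:R^-1.
Proof.
move=> z0; pose ps := [seq p <- index_iota 0 z.+1 | prime p].
have pps : all prime ps by rewrite filter_all.
have cv := coprime_inv_sq_sum_cvg ps pps (filter_uniq _ (iota_uniq _ _)).
rewrite -big_filter -/ps -(cvg_lim _ cv) //.
have cvn : cvgn (coprime_inv_sq_sum ps) by apply/cvg_ex; eexists; exact: cv.
have sumE n : (0 < n)%N -> coprime_inv_sq_sum ps n
    = 1 + \sum_(2 <= k < n.+1 | all (fun p => ~~ (p %| k)%N) ps) (k ^ 2)%:R^-1.
  move=> n0; rewrite /coprime_inv_sq_sum big_mkcond big_ltn // big_ltn // -big_mkcond /=.
  rewrite exp0n // invr0 if_same add0r exp1n invr1.
  rewrite (_ : all _ _ = true) //; apply/allP => p pps'.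
  by rewrite dvdn1; have /prime_gt1 := allP pps _ pps'; case: p {pps'} => [|[]].
apply/andP; split.
  apply: limr_ge => //; near=> n.
  rewrite sumE; last by near: n; exact: nbhs_infty_gt.
  by rewrite lerDl sumr_ge0 // => k _; rewrite invr_ge0.
apply: limr_le => //; near=> n.
have zn : (z <= n)%N by near: n; exact: nbhs_infty_ge.
rewrite sumE; last exact: leq_trans zn.
rewrite lerD2l; apply: le_trans _ (sum_inv_sq_tail z n z0).
rewrite big_mkcond (big_cat_nat (n := z.+1)) //=.
rewrite big_nat big1 ?add0r => [|k /andP[k2 kz]].
  by apply: ler_sum => k _; case: ifP; rewrite ?invr_ge0.
case: ifP => // /allP /(_ (pdiv k)).
rewrite mem_filter pdiv_prime // mem_index_iota /= pdiv_dvd.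
rewrite (leq_ltn_trans (pdiv_leq _) kz); last exact: leq_trans k2.
by move=> /(_ isT).
Unshelve. all: by end_near.
Qed.

Lemma zeta2_ge1 : 1 <= zeta (2 : R).
Proof.
rewrite -(cvg_lim _ zeta2_cvg) //; apply: limr_ge.
  by apply/cvg_ex; eexists; exact: zeta2_cvg.
near=> n; rewrite -coprime_inv_sq_sum_nil /coprime_inv_sq_sum.
have n0 : (0 < n)%N by near: n; exact: nbhs_infty_gt.
rewrite big_mkcond big_ltn // big_ltn //= exp0n // invr0 add0r exp1n invr1.
by rewrite lerDl sumr_ge0.
Unshelve. all: by end_near.
Qed.

Lemma inv_nat_cvg0 : (n%:R^-1 : R) @[n --> \oo] --> (0 : R).
Proof. by rewrite -cvg_shiftS; exact: cvg_harmonic. Qed.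

Lemma zeta2_euler_product :
  \prod_(0 <= p < z.+1 | prime p) (1 - 1 / p%:R ^+ 2) @[z --> \oo]
    --> (zeta (2 : R))^-1.
Proof.
have z1 := zeta2_ge1; have z0 : 0 < zeta (2 : R) by rewrite (lt_le_trans _ z1).
rewrite -[(zeta 2)^-1]mulr1.
have -> : (fun z : nat => \prod_(0 <= p < z.+1 | prime p) (1 - 1 / p%:R ^+ 2) : R)
  = (fun z : nat => (zeta (2 : R))^-1 *
      (zeta (2 : R) * \prod_(0 <= p < z.+1 | prime p) (1 - 1 / p%:R ^+ 2))).
  by apply/funext => z; rewrite mulKf ?gt_eqF.
apply: cvgM; first exact: cvg_cst.
apply: (squeeze_cvgr (f := fun=> 1) (h := fun z : nat => 1 + z%:R^-1)).
- near=> z; apply: zeta2_prime_prod_bounds.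
  by near: z; exact: nbhs_infty_gt.
- exact: cvg_cst.
- rewrite -[X in _ --> X]addr0; apply: cvgD; [exact: cvg_cst|exact: inv_nat_cvg0].
Unshelve. all: by end_near.
Qed.

(** All factors lie between 0 and 1, so the partial products decrease and are bounded below. *)
Lemma prime_prod_inv_sq_pred_cvg (P : pred nat) :
  (\prod_(0 <= p < n | prime p && P p) (1 - 1 / (p%:R ^+ 2 - 1)) : R) @[n --> \oo]
    --> prime_product P (fun p => 1 - 1 / (p%:R ^+ 2 - 1) : R).
Proof.
have fac p : prime p -> 0 <= 1 - 1 / ((p%:R : R) ^+ 2 - 1) <= 1.
  move=> /prime_gt1 p1.
  have p4 : 4 <= p%:R ^+ 2 :> R by rewrite -natrX ler_nat (@leq_exp2r 2 p 2).
  have d1 : 1 <= p%:R ^+ 2 - 1 :> R by lra.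
  have d0 : 0 < p%:R ^+ 2 - 1 :> R by lra.
  by rewrite subr_ge0 gerBl div1r invf_le1 // invr_ge0 d1 ltW.
have prod0 n : 0 <= \prod_(0 <= p < n | prime p && P p) (1 - 1 / (p%:R ^+ 2 - 1)) :> R.
  by apply: prodr_ge0 => p /andP[/fac/andP[]].
apply: nonincreasing_is_cvgn; last by exists 0 => _ [n _ <-].
apply/nonincreasing_seqP => n; rewrite big_mkcond big_nat_recr //= -big_mkcond.
case: ifPn => [/andP[/fac/andP[_ f1] _]|_]; last by rewrite mulr1.
exact: ler_piMr.
Qed.

End EulerProduct.

(** * Assembling the asymptotics *)

(** The factorization [1 - 2/p^2 = (1 - 1/p^2) * (1 - 1/(p^2 - 1))] splits off the Euler product of
    [1 / zeta 2], from which the primes dividing [K * gamma] are then divided out. *)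
Lemma sieve_density_cvg (R : realType) (gamma K Q2 : nat) :
  (0 < gamma)%N -> (0 < K)%N -> (K * gamma %| Q2)%N ->
  ((sieve_density gamma K Q2 z.+1 : R) @[z --> \oo] -->
    (totient K)%:R / ((K * gamma ^ 2)%:R * zeta (2 : R))
    * (\prod_(p <- primes (K * gamma)) (1 - 1 / p%:R ^+ 2)^-1)
    * prime_product (fun p => ~~ (p %| Q2)%N) (fun p => 1 - 1 / (p%:R ^+ 2 - 1)))%classic.
Proof.
move=> gamma_gt0 K_gt0 Q_dvd; set Q1 := (K * gamma)%N in Q_dvd *.
have Q1_gt0 : (0 < Q1)%N by rewrite muln_gt0 K_gt0.
pose u (p : nat) : R := 1 - 1 / p%:R ^+ 2.
pose v (p : nat) : R := 1 - 1 / (p%:R ^+ 2 - 1).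
pose B : R := \prod_(p <- primes Q1) (u p)^-1.
have p4 p : prime p -> 4 <= (p%:R : R) ^+ 2.
  by move=> /prime_gt1 p1; rewrite -natrX ler_nat (@leq_exp2r 2 p 2).
have u_neq0 p : prime p -> u p != 0.
  move=> /p4 pp; rewrite /u subr_eq0 eq_sym.
  by rewrite lt_eqF // ltr_pdivrMr ?mul1r; lra.
(* For [z >= Q1] every prime dividing [Q1] lies in the range of the product. *)
have densE z : (Q1 <= z)%N -> sieve_density gamma K Q2 z.+1 =
    (totient K)%:R / (K * gamma ^ 2)%:R
    * (\prod_(0 <= p < z.+1 | prime p) u p * B)
    * \prod_(0 <= p < z.+1 | prime p && ~~ (p %| Q2)%N) v p.
  move=> Qz; rewrite /sieve_density [(gamma ^ 2 * K)%N]mulnC -[RHS]mulrA; congr (_ * _).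
  have -> : \prod_(0 <= p < z.+1 | prime p) u p * B
      = \prod_(0 <= p < z.+1 | prime p && ~~ (p %| Q1)%N) u p.
    rewrite (bigID (fun p => p %| Q1)%N) /= mulrAC.
    rewrite [X in X * _](_ : _ = 1) ?mul1r //.
    have -> : B = \prod_(0 <= p < z.+1 | prime p && (p %| Q1)%N) (u p)^-1.
      rewrite -big_filter /B; apply: perm_big; apply: uniq_perm.
      - exact: primes_uniq.
      - exact/filter_uniq/iota_uniq.
      move=> p; rewrite mem_primes mem_filter mem_index_iota /= Q1_gt0 /= ltnS.
      case: (prime p) => //=; case: (boolP (p %| Q1)%N) => //= pQ.
      by rewrite (leq_trans (dvdn_leq _ pQ)).
    rewrite -big_split /= big1 // => p /andP[pp _].
    by rewrite mulfV ?u_neq0.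
  have -> : \prod_(0 <= p < z.+1 | prime p && ~~ (p %| Q2)%N) v p
      = \prod_(0 <= p < z.+1 | prime p && ~~ (p %| Q1)%N)
          (if (p %| Q2)%N then 1 else v p).
    rewrite [RHS](bigID (fun p => p %| Q2)%N) /= [X in X * _]big1 ?mul1r; last first.
      by move=> p /andP[_ ->].
    apply: eq_big => [p|p /andP[_ /negPf -> //]].
    case: (prime p) => //=; case: (boolP (p %| Q2)%N) => pQ2; rewrite ?andbF ?andbT //.
    by apply/esym; apply: contraNN pQ2 => /dvdn_trans; apply.
  rewrite -big_split /= /sieving_primes big_filter /index_iota subn0.
  apply: eq_bigr => p /andP[/p4 pp _]; rewrite natrX /u /v.
  have e1 : (p%:R : R) ^+ 2 != 0 by rewrite gt_eqF //; lra.
  have e2 : (p%:R : R) ^+ 2 - 1 != 0 by rewrite gt_eqF //; lra.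
  move: (p%:R ^+ 2) e1 e2 => x e1 e2.
  by case: (p %| Q2)%N => /=; field; rewrite ?e1 ?e2.
have cvP := prime_prod_inv_sq_pred_cvg (R := R) (fun p => ~~ (p %| Q2)%N).
have cvS : (\prod_(0 <= p < z.+1 | prime p && ~~ (p %| Q2)%N) v p @[z --> \oo] -->
    prime_product (fun p => ~~ (p %| Q2)%N) v)%classic.
  have := cvP; rewrite -cvg_shiftS; exact.
have cvE := zeta2_euler_product (R := R).
rewrite invfM mulrA -[_ / zeta 2 * B]mulrA.
have cv : ((totient K)%:R / (K * gamma ^ 2)%:R
    * (\prod_(0 <= p < z.+1 | prime p) u p * B)
    * \prod_(0 <= p < z.+1 | prime p && ~~ (p %| Q2)%N) v p @[z --> \oo] -->
    (totient K)%:R / (K * gamma ^ 2)%:R * ((zeta (2 : R))^-1 * B)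
    * prime_product (fun p => ~~ (p %| Q2)%N) v)%classic.
  apply: cvgM => //; apply: cvgM; first exact: cvg_cst.
  by apply: cvgM => //; exact: cvg_cst.
apply: cvg_trans cv; apply: near_eq_cvg; near=> z.
by apply/esym/densE; near: z; exact: nbhs_infty_ge.
Unshelve. all: by end_near.
Qed.

Lemma fourth_root_exists (n : nat) : (0 < n)%N ->
  exists w, [/\ (0 < w)%N, (w ^ 4 <= n)%N & (n < w.+1 ^ 4)%N].
Proof.
move=> n0; pose P w := (w ^ 4 <= n)%N.
have P1 : exists w, P w by exists 1%N; rewrite /P exp1n.
have Pn w : P w -> (w <= n)%N.
  by apply: leq_trans; rewrite -{1}[w]expn1; case: w => // w; rewrite leq_pexp2l.
case: (ex_maxnP P1 Pn) => w Pw wmax; exists w; split => //.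
- by rewrite wmax // /P exp1n.
- by rewrite ltnNge; apply/negP => /wmax; rewrite ltnn.
Qed.

(** A comparison prime by prime. At primes of [gamma] the class of [rho] decides both conditions; at
    primes of [alpha0 * beta0] coprimality protects [y]; a prime of [alpha] dividing the linear form
    would divide [beta]. *)
Lemma squarefree_pair_sieved (beta : int) (gamma alpha alpha0 beta0 rho y : nat) :
  coprimez alpha%:Z beta ->
  (forall p : nat, prime p -> (p%:Z %| beta)%Z -> ((p ^ 2)%N%:Z %| beta)%Z) ->
  (alpha0 %| alpha)%N -> squarefree beta0%:Z -> (beta0%:Z %| beta)%Z ->
  coprime (alpha0 * beta0 * rho) gamma ->
  (forall p : nat, prime p -> (p %| gamma)%N ->
     ((alpha * beta0 * rho)%N%:Z + beta != 0 %[mod (p ^ 2)%N%:Z])%Z) ->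
  [&& y == rho %[mod gamma ^ 2], coprime y (alpha0 * beta0),
      `[< squarefree y%:Z >]
    & `[< squarefree ((alpha * beta0 * y)%N%:Z + beta) >]]
  = sieved (alpha * beta0) beta gamma (alpha0 * beta0) rho (alpha * `|beta| * gamma) y.
Proof.
move=> ab bsf a0a b0sf b0b cop nz; rewrite /sieved /sieve_base -andbA.
have [yr|//] := eqVneq (y %% gamma ^ 2)%N (rho %% gamma ^ 2)%N.
have [yK|//] := boolP (coprime y (alpha0 * beta0)); rewrite /=.
have eq_mod p : (p %| gamma)%N -> y = rho %[mod p ^ 2].
  move=> pg; have pg2 : (p ^ 2 %| gamma ^ 2)%N by rewrite dvdn_exp2r.
  by rewrite -(modn_dvdm y pg2) yr modn_dvdm.
have not_both p : prime p -> (p %| alpha)%N -> (p %| `|beta|)%N -> False.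
  move=> pp pa pb; have : coprime p p by apply: coprime_dvdl pa (coprime_dvdr pb ab).
  by rewrite prime_coprime // dvdnn.
have y_prime p : prime p -> (p %| y)%N -> ~~ (p %| alpha0 * beta0)%N.
  move=> pp py; rewrite -prime_coprime //; exact: coprime_dvdl py yK.
apply/andP/andP => -[/asboolP sf1 /asboolP sf2]; split; apply/asboolP.
- by move=> p pp _; have := sf1 p pp; rewrite dvdzE.
- by move=> p pp _; have := sf2 p pp; rewrite dvdn_linear_form.
- move=> p pp; rewrite dvdzE /=; apply/negP => py2.
  have py : (p %| y)%N by apply: dvdn_trans py2; rewrite dvdn_exp.
  have [pg|pg] := boolP (p %| gamma)%N.
    have : (p ^ 2 %| rho)%N by rewrite /dvdn -(eq_mod p pg).
    move=> /(dvdn_trans (dvdn_exp _ (dvdnn p))) -/(_ isT) prho.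
    have : coprime p p.
      by apply: coprime_dvdr pg (coprime_dvdl _ cop); rewrite dvdn_mull.
    by rewrite prime_coprime // dvdnn.
  move: (sf1 p pp); rewrite py2 Euclid_dvdM // (negPf pg) orbF.
  by rewrite (y_prime p pp py) => /(_ isT).
have sfy p : prime p -> ~~ (p ^ 2 %| y)%N.
  move=> pp; have [pg|pg] := boolP (p %| gamma)%N; last first.
    apply/negP => py2.
    have py : (p %| y)%N by apply: dvdn_trans py2; rewrite dvdn_exp.
    move: (sf1 p pp); rewrite py2 Euclid_dvdM // (negPf pg) orbF.
    by rewrite (y_prime p pp py) => /(_ isT).
  apply/negP => py2.
  have : (p ^ 2 %| rho)%N by rewrite /dvdn -(eq_mod p pg).
  move=> /(dvdn_trans (dvdn_exp _ (dvdnn p))) -/(_ isT) prho.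
  have : coprime p p.
    by apply: coprime_dvdr pg (coprime_dvdl _ cop); rewrite dvdn_mull.
  by rewrite prime_coprime // dvdnn.
move=> p pp; apply/negP => pf2.
have pf : (p%:Z %| (alpha * beta0 * y)%N%:Z + beta)%Z.
  by apply: dvdz_trans pf2; rewrite dvdzE /= dvdn_exp.
have [|pQ] := boolP (p %| alpha * `|beta| * gamma)%N; last first.
  by have := sf2 p pp pQ; rewrite dvdn_linear_form pf2.
rewrite !Euclid_dvdM // => /orP[/orP[pa|pb]|pg].
- apply: (not_both p pp pa); move: pf; rewrite rpredDl ?dvdzE //.
  by rewrite dvdn_mulr // dvdn_mulr.
(* Since [p ^ 2] divides [beta] and [p] does not divide [alpha], [p ^ 2] divides [beta0 * y]. If [p]
   divides [beta0] then it does not divide [y], and [beta0] fails to be squarefree; otherwise [y]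
   does. *)
- have pb2 : ((p ^ 2)%N%:Z %| beta)%Z by apply: bsf => //; rewrite dvdzE.
  have npa : ~~ (p %| alpha)%N by apply/negP => pa; exact: (not_both p).
  move: pf2; rewrite rpredDr // dvdzE /= -mulnA Gauss_dvdr; last first.
    by rewrite coprimeXl // prime_coprime.
  have [pb0|pb0] := boolP (p %| beta0)%N.
    rewrite Gauss_dvdl; last first.
      rewrite coprimeXl // prime_coprime //; apply/negP => py.
      by have := y_prime p pp py; rewrite dvdn_mull.
    by move=> H; have := b0sf p pp; rewrite dvdzE /= H.
  rewrite Gauss_dvdr; last by rewrite coprimeXl // prime_coprime.
  exact/negP/sfy.
- move: pf2 (nz p pp pg); rewrite eqz_mod_dvd subr0 -!dvdn_linear_form.
  rewrite (periodic_eqmod (fun x => p ^ 2 %| linear_form (alpha * beta0) beta x)%N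
    _ _ _ _ (eq_mod p pg)) => [->//|x].
  exact: linear_form_periodic.
Qed.

Theorem theorem3p8 (R : realType) (beta : int)
  (gamma alpha alpha0 beta0 : nat)
  (gamma_gt0 : (0 < gamma)%N) (alpha_gt0 : (0 < alpha)%N)
  (alpha0_gt0 : (0 < alpha0)%N) (beta0_gt0 : (0 < beta0)%N)
  (coprime_alpha_beta : coprimez alpha%:Z beta)
  (beta_squarefull : forall p : nat, prime p ->
     (p%:Z %| beta)%Z -> ((p ^ 2)%N%:Z %| beta)%Z)
  (alpha0_squarefree : squarefree alpha0%:Z)
  (alpha0_dvd : (alpha0 %| alpha)%N)
  (beta0_squarefree : squarefree beta0%:Z)
  (beta0_dvd : (beta0%:Z %| beta)%Z) :
  exists C : R, forall (rho : nat),
    (0 < rho)%N ->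
    coprime (alpha0 * beta0 * rho) gamma ->
    (forall p : nat, prime p -> (p %| gamma)%N ->
       ((alpha * beta0 * rho)%N%:Z + beta != 0 %[mod (p ^ 2)%N%:Z])%Z) ->
    forall X : R, 1 <= X ->
      `| (U beta gamma alpha alpha0 beta0 rho X)%:R
         - X * ((totient (alpha0 * beta0))%:R
                / ((alpha0 * beta0 * gamma ^ 2)%N%:R * zeta (2 : R)))
             * (\prod_(p <- primes (alpha0 * beta0 * gamma))
                  (1 - 1 / p%:R ^+ 2)^-1)
             * prime_product
                 (fun p => ~~ (p%:Z %| alpha%:Z * beta * gamma%:Z)%Z)
                 (fun p => 1 - 1 / (p%:R ^+ 2 - 1)) |
      <= C * X `^ (3 / 4).
Proof.
set K := (alpha0 * beta0)%N; set Q2 := (alpha * `|beta| * gamma)%N.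
have K_gt0 : (0 < K)%N by rewrite muln_gt0 alpha0_gt0.
have Q1_dvd : (K * gamma %| Q2)%N by rewrite !dvdn_mul // -dvdzE.
have a_gt0 : (0 < alpha * beta0)%N by rewrite muln_gt0 alpha_gt0.
have a_dvd : (alpha * beta0 %| Q2)%N by rewrite dvdn_mulr // dvdn_mul // -dvdzE.
have b_dvd : (`|beta| %| Q2)%N by rewrite dvdn_mulr // dvdn_mull.
have -> : (fun p : nat => ~~ (p%:Z %| alpha%:Z * beta * gamma%:Z)%Z)
    = (fun p : nat => ~~ (p %| Q2)%N).
  by apply/funext => p; rewrite dvdzE !abszM.
have := sieve_density_cvg R gamma K Q2 gamma_gt0 K_gt0 Q1_dvd.
set D := _ * _ * _ => cvD.
pose err := sieve_error (alpha * beta0) beta K.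
(* The three summands pay for moving the window past [|beta|], for the sieve, and for replacing the
   floor of [X] by [X]. None depends on [rho]. *)
exists (`|beta|%N%:R + 16 * err%:R + `|D|) => rho rho_gt0 cop nz X X1.
have K_gamma : coprime K gamma by apply: coprime_dvdl cop; rewrite dvdn_mulr.
rewrite -2!mulrA [_ * (\prod_(_ <- _) _ * _)]mulrA -/D.
have X0 : 0 <= X by exact: le_trans ler01 X1.
set n := Num.truncn X.
have [nX Xn] : n%:R <= X /\ X < n.+1%:R by apply/andP; exact: truncn_itv.
have n_gt0 : (0 < n)%N by rewrite truncn_gt0.
have [w [w_gt0 wn nw]] := fourth_root_exists n n_gt0.
pose V := count (sieved (alpha * beta0) beta gamma K rho Q2) (iota `|beta|.+1 n).
(* Here [w] and [n] stay fixed while [z] tends to infinity, which removes the term [3 / z]. *)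
have VD : `|V%:R / n%:R - D| <= err%:R / w%:R.
  have cvl : (`|V%:R / n%:R - sieve_density gamma K Q2 z.+1| @[z --> \oo]
      --> `|V%:R / n%:R - D|)%classic.
    by apply: cvg_norm; apply: cvgB cvD; exact: cvg_cst.
  have cvr : ((err%:R / w%:R + 3 / z%:R : R) @[z --> \oo]
      --> (err%:R / w%:R : R))%classic.
    rewrite -[X in (_ --> X)%classic]addr0; apply: cvgD; first exact: cvg_cst.
    by rewrite -[X in (_ --> X)%classic](mulr0 3); apply: cvgM; [exact: cvg_cst|exact: inv_nat_cvg0].
  apply: ler_cvg_to cvl cvr _; near=> z; apply: sieved_over_N_density => //.
  by near: z; exact: nbhs_infty_gt.
(* The two windows of length [n] differ by [|beta|] integers at each end. *)
have UV : `|(U beta gamma alpha alpha0 beta0 rho X)%:R - V%:R| <= `|beta|%N%:R :> R.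
  have -> : U beta gamma alpha alpha0 beta0 rho X
      = count (sieved (alpha * beta0) beta gamma K rho Q2) (iota 1 n).
    by apply: eq_count => y; apply: squarefree_pair_sieved.
  rewrite /V; set f := sieved _ _ _ _ _ _.
  have shift : (count f (iota 1 n) + count f (iota n.+1 `|beta|)
      = count f (iota 1 `|beta|) + count f (iota `|beta|.+1 n))%N.
    by rewrite -!count_cat -[n.+1]add1n -[`|beta|.+1]add1n -!iotaD addnC.
  have small t : (count f (iota t `|beta|) <= `|beta|)%N.
    by rewrite -[leqRHS](size_iota t) count_size.
  have arith (x y c d e : nat) : (x + c = d + y)%N -> (c <= e)%N -> (d <= e)%N ->
      (y <= x + e)%N && (x <= y + e)%N by clear; lia.
  by rewrite ler_distl lerBlDr -!natrD !ler_nat; apply: arith shift _ _.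
have n0R : 0 < n%:R :> R by rewrite ltr0n.
have w0R : 0 < w%:R :> R by rewrite ltr0n.
have VnD : `|V%:R - n%:R * D| <= 16 * err%:R * (w ^ 3)%:R.
  have -> : V%:R - n%:R * D = (V%:R / n%:R - D) * n%:R by field; rewrite gt_eqF.
  rewrite normrM (ger0_norm (ltW n0R)).
  apply: le_trans (ler_wpM2r (ltW n0R) VD) _.
  rewrite mulrAC ler_pdivrMr // -!natrM ler_nat.
  (* The 16 comes from [n < (w + 1)^4 <= (2 * w)^4]. *)
  apply: (@leq_trans (err * (16 * w ^ 4))).
    rewrite leq_mul2l (leq_trans (ltnW nw)) ?orbT //.
    by rewrite -(expnMn 2 w 4) leq_exp2r // mul2n -addnn -addn1 leq_add2l.
  by apply/eq_leq; ring.
have w3X : (w ^ 3)%:R <= X `^ (3 / 4).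
  have w4X : w%:R `^ 4%:R <= X by rewrite powR_mulrn // -natrX (le_trans _ nX) ?ler_nat.
  have -> : (w ^ 3)%:R = (w%:R `^ 4%:R) `^ (3 / 4) :> R.
    by rewrite -powRrM mulrCA mulfV // mulr1 (powR_mulrn 3) // natrX.
  by apply: ge0_ler_powR; rewrite ?nnegrE ?powR_ge0.
have X34 : 1 <= X `^ (3 / 4).
  by apply: le_trans w3X; rewrite ler1n expn_gt0 w_gt0.
have XnD : `|n%:R * D - X * D| <= `|D|.
  rewrite -mulrBl normrM ler_piMl // distrC ger0_norm ?subr_ge0 //.
  by rewrite lerBlDl natr1 ltW.
apply: le_trans (ler_distD V%:R _ _) _.
apply: le_trans (lerD UV (le_trans (ler_distD (n%:R * D) _ _) (lerD VnD XnD))) _.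
rewrite -addrA [leRHS]mulrDl [X in _ <= _ + X]mulrDl; apply: lerD.
  exact: ler_peMr.
by apply: lerD; [apply: ler_wpM2l; rewrite ?mulr_ge0|exact: ler_peMr].
Unshelve. all: by end_near.
Qed.
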